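(* Let $n\geq 4$. The principal level 2 congruence subgroup $\Gamma_n[2]$ of $\mathrm{GL}(n,\mathbb{Z})$ has a finite presentation with generating set $\{S_{ij},O_i \mid 1\leq i\neq j\leq n\}$ and defining relators 1. $O_i^2$; 2. $[O_i,O_j]$; 3. $(O_iS_{ij})^2$; 4. $(O_jS_{ij})^2$; 5. $[O_i,S_{jk}]$; 6. $[S_{ki},S_{kj}]$; 7. $[S_{ij},S_{kl}]$; 8. $[S_{ji},S_{ki}]$; 9. $[S_{kj},S_{ji}]S_{ki}^{-2}$; 10. $(S_{ij}S_{ik}^{-1}S_{ki}S_{ji}S_{jk}S_{kj}^{-1})^2$; where, in each relator, the indices $i,j,k,l\in\{1,\dots,n\}$ occurring are pairwise different and range over all such choices.
   Context: $\Gamma_n[2]$ is the kernel of the homomorphism $\mathrm{GL}(n,\mathbb{Z})\to\mathrm{GL}(n,\mathbb{Z}/2)$ reducing matrix entries mod 2. For $i\neq j$, $S_{ij}\in\Gamma_n[2]$ is the matrix with $1$s on the diagonal, $2$ in the $(i,j)$ position and $0$s elsewhere. $O_i\in\Gamma_n[2]$ differs from the identity matrix only in having $-1$ in the $(i,i)$ position. Write $[g,h]=ghg^{-1}h^{-1}$. *)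

(* Defs.v *)
From HB Require Import structures.
From mathcomp Require Import all_boot all_order all_algebra.

Set Implicit Arguments.
Unset Strict Implicit.
Unset Printing Implicit Defensive.

Import GRing.Theory.
Local Open Scope group_scope.

(* Unlike MathComp's [~ g, h], which is g^-1 * h^-1 * g * h. *)
Definition bracket (G : groupType) (g h : G) : G := g * h * g^-1 * h^-1.

(* The free group on X: reduced words, where the letter (x, true) stands for x
   and (x, false) for x^-1; each letter of a product is pushed onto the reduced
   word to its right, cancelling when possible. *)
Section FreeGroup.
Variable X : eqType.
Implicit Types (a : X * bool) (u v w : seq (X * bool)).

Definition inv_letter a : X * bool := (a.1, ~~ a.2).

Definition reduced w : bool := sorted (fun a b => b != inv_letter a) w.

Definition push a w : seq (X * bool) :=
  if w is b :: w' then if b == inv_letter a then w' else a :: w else [:: a].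

Definition inv_word w : seq (X * bool) := rev (map inv_letter w).

Lemma inv_letterK : involutive inv_letter.
Proof. by case=> x b; rewrite /inv_letter /= negbK. Qed.

Lemma inv_letter_neq a : a != inv_letter a.
Proof. by case: a => x b; rewrite /inv_letter xpair_eqE eqxx; case: b. Qed.

Lemma reduced_push a w : reduced w -> reduced (push a w).
Proof.
case: w => [|b w] //= rw; case: ifP => [_|/negbT ab].
  exact: path_sorted rw.
by rewrite /reduced /= ab.
Qed.

Lemma reduced_foldr u w : reduced w -> reduced (foldr push w u).
Proof. by move=> rw; elim: u => //= a u; apply: reduced_push. Qed.

Lemma pushK a w : reduced w -> push (inv_letter a) (push a w) = w.
Proof.
case: w => [|b w] /=; first by rewrite inv_letterK eqxx.
case: (eqVneq b (inv_letter a)) => [->|ab _] /=; last by rewrite inv_letterK eqxx.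
case: w => [|c w] //; rewrite /reduced /=.
by case: (eqVneq c (inv_letter (inv_letter a))).
Qed.

Lemma foldr_push_push a v w : reduced w ->
  foldr push w (push a v) = push a (foldr push w v).
Proof.
move=> rw; case: v => [|b v] //=; case: eqP => [->|] //=.
rewrite -{1}(inv_letterK a) pushK //; exact: reduced_foldr.
Qed.

Lemma foldr_push_foldr u v w : reduced w ->
  foldr push w (foldr push v u) = foldr push (foldr push w v) u.
Proof. by move=> rw; elim: u => //= a u IH; rewrite foldr_push_push // IH. Qed.

Lemma foldr_push_nil w : reduced w -> foldr push [::] w = w.
Proof.
elim: w => //= a w IH rw; rewrite IH; last exact: path_sorted rw.
by move: rw; case: w {IH} => //= b w; rewrite /reduced /= => /andP[/negbTE-> _].
Qed.

Lemma reduced_inv w : reduced w -> reduced (inv_word w).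
Proof.
rewrite /reduced /inv_word rev_sorted sorted_map; apply: sub_sorted => a b ab.
by rewrite /relpre /= inv_letterK eq_sym.
Qed.

Lemma foldr_push_inv w v : reduced v ->
  foldr push (foldr push v w) (inv_word w) = v.
Proof.
move=> rv; elim: w => //= a w IH.
rewrite /inv_word /= rev_cons -cats1 foldr_cat /= pushK //.
exact: reduced_foldr.
Qed.

Record free_group := FreeWord { letters :> seq (X * bool); _ : reduced letters }.

HB.instance Definition _ := [isSub for letters].
HB.instance Definition _ := [Equality of free_group by <:].

End FreeGroup.

HB.instance Definition _ (X : choiceType) := [Choice of free_group X by <:].

Section FreeGroupGroup.
Variable X : choiceType.
Implicit Types u v w : free_group X.

Definition free_one : free_group X := FreeWord (isT : reduced [::]).
Definition free_inv w : free_group X := FreeWord (reduced_inv (valP w)).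
Definition free_mul u v : free_group X := FreeWord (reduced_foldr u (valP v)).

Lemma free_mulA : associative free_mul.
Proof. by move=> u v w; apply/val_inj; rewrite /= foldr_push_foldr ?(valP w). Qed.

Lemma free_mul1 : left_id free_one free_mul.
Proof. by move=> w; apply/val_inj. Qed.

Lemma free_mulr1 : right_id free_one free_mul.
Proof. by move=> w; apply/val_inj; rewrite /= foldr_push_nil ?(valP w). Qed.

Lemma free_mulV : left_inverse free_one free_inv free_mul.
Proof.
move=> w; apply/val_inj; rewrite /=.
by rewrite -{1}(foldr_push_nil (valP w)) foldr_push_inv.
Qed.

Lemma inv_wordK : involutive (@inv_word X).
Proof.
move=> w; rewrite /inv_word map_rev revK -map_comp map_id_in // => a _.
exact: inv_letterK.
Qed.

Lemma free_mulrV : right_inverse free_one free_inv free_mul.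
Proof.
move=> w; rewrite -{1}[w](_ : free_inv (free_inv w) = w) ?free_mulV //.
by apply/val_inj; rewrite /= inv_wordK.
Qed.

HB.instance Definition _ := isGroup.Build (free_group X)
  free_mulA free_mul1 free_mulr1 free_mulV free_mulrV.

Definition free_gen (x : X) : free_group X :=
  FreeWord (isT : reduced [:: (x, true)]).

Variables (G : groupType) (f : X -> G).

(* The homomorphism from the free group on X to G extending f. *)
Definition free_lift w : G :=
  \prod_(a <- letters w) (if a.2 then f a.1 else (f a.1)^-1).

Lemma free_lift_gen x : free_lift (free_gen x) = f x.
Proof. by rewrite /free_lift big_seq1. Qed.

Lemma free_lift_morphism : monoid.monoid_morphism free_lift.
Proof.
split=> [|u v]; first by rewrite /free_lift big_nil.
rewrite /free_lift /=; elim: (letters u) => [|a s IH] /=.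
  by rewrite big_nil mul1g.
rewrite big_cons -mulgA -IH; case: (foldr _ _ _) => [|b t] /=.
  by rewrite big_seq1 big_nil mulg1.
case: eqP => [->|_]; rewrite !big_cons //=.
by case: a.2; rewrite /= ?mulVKg ?mulKg.
Qed.

HB.instance Definition _ :=
  isUMagmaMorphism.Build (free_group X) G free_lift free_lift_morphism.

End FreeGroupGroup.

Definition normal_subgroup (G : groupType) (N : G -> Prop) : Prop :=
  [/\ N 1,
      forall g h, N g -> N h -> N (g * h),
      forall g, N g -> N g^-1
    & forall g h, N g -> N (h * g * h^-1)].

Definition normal_closure (G : groupType) (R : G -> Prop) (g : G) : Prop :=
  forall N : G -> Prop,
    normal_subgroup N -> (forall r, R r -> N r) -> N g.

(* < X | R > is a presentation of G, with x in X standing for f x in G. *)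
Definition is_presentation (G : groupType) (X : choiceType) (f : X -> G)
    (R : free_group X -> Prop) : Prop :=
  (forall g : G, exists w, free_lift f w = g) /\
  (forall w, free_lift f w = 1 <-> normal_closure R w).

Definition is_finite_presentation (G : groupType) (X : finType) (f : X -> G)
    (R : free_group X -> Prop) : Prop :=
  is_presentation f R /\
  exists rs : seq (free_group X), forall r, R r <-> r \in rs.

(* MathComp's {'GL_n[R]} requires R to be finite. *)
Record GLmx (n : nat) (R : comUnitRingType) :=
  GLMx { GLmxval :> 'M[R]_n; _ : GLmxval \in unitmx }.

Section GLmxGroup.
Variables (n : nat) (R : comUnitRingType).

HB.instance Definition _ := [isSub for @GLmxval n R].
HB.instance Definition _ := [Choice of GLmx n R by <:].

Implicit Types A B : GLmx n R.

Definition GLmx_one : GLmx n R := GLMx (unitmx1 R n).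

Fact GLmx_inv_subproof A : invmx A \in unitmx.
Proof. by rewrite unitmx_inv (valP A). Qed.
Definition GLmx_inv A : GLmx n R := GLMx (GLmx_inv_subproof A).

Fact GLmx_mul_subproof A B : (A *m B)%R \in unitmx.
Proof. by rewrite unitmx_mul (valP A) (valP B). Qed.
Definition GLmx_mul A B : GLmx n R := GLMx (GLmx_mul_subproof A B).

Lemma GLmx_mulA : associative GLmx_mul.
Proof. by move=> A B C; apply/val_inj; rewrite /= mulmxA. Qed.
Lemma GLmx_mul1 : left_id GLmx_one GLmx_mul.
Proof. by move=> A; apply/val_inj; rewrite /= mul1mx. Qed.
Lemma GLmx_mulr1 : right_id GLmx_one GLmx_mul.
Proof. by move=> A; apply/val_inj; rewrite /= mulmx1. Qed.
Lemma GLmx_mulV : left_inverse GLmx_one GLmx_inv GLmx_mul.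
Proof. by move=> A; apply/val_inj; rewrite /= mulVmx ?(valP A). Qed.
Lemma GLmx_mulrV : right_inverse GLmx_one GLmx_inv GLmx_mul.
Proof. by move=> A; apply/val_inj; rewrite /= mulmxV ?(valP A). Qed.

HB.instance Definition _ := isGroup.Build (GLmx n R)
  GLmx_mulA GLmx_mul1 GLmx_mulr1 GLmx_mulV GLmx_mulrV.

End GLmxGroup.

Section Gamma2.
Variable n : nat.

Fact mod2_subproof (A : GLmx n int) :
  map_mx (intr : int -> 'Z_2) A \in unitmx.
Proof. by rewrite unitmxE det_map_mx rmorph_unit // -unitmxE (valP A). Qed.

Definition mod2 (A : GLmx n int) : GLmx n 'Z_2 := GLMx (mod2_subproof A).

Lemma mod2_morphism : monoid.monoid_morphism mod2.
Proof.
split=> [|A B]; apply/val_inj; rewrite /= ?map_mx1 //.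
exact: map_mxM.
Qed.

HB.instance Definition _ :=
  isUMagmaMorphism.Build (GLmx n int) (GLmx n 'Z_2) mod2 mod2_morphism.

Definition ker_mod2 : {pred GLmx n int} := [pred A | mod2 A == 1].

Lemma ker_mod2_group_closed : group_closed ker_mod2.
Proof.
split=> [|A B]; rewrite !inE ?gmulf1 // => /eqP A1 /eqP B1.
by rewrite gmulfF /= A1 B1 divg1.
Qed.

Record Gamma2 := MkGamma2 { Gamma2val :> GLmx n int; _ : Gamma2val \in ker_mod2 }.

HB.instance Definition _ := [isSub for Gamma2val].
HB.instance Definition _ := [Choice of Gamma2 by <:].
HB.instance Definition _ :=
  SubChoice_isSubGroup.Build (GLmx n int) ker_mod2 Gamma2 ker_mod2_group_closed.

Local Open Scope ring_scope.

Definition S_mx (i j : 'I_n) : 'M[int]_n := 1%:M + 2 *: delta_mx i j.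
Definition O_mx (i : 'I_n) : 'M[int]_n :=
  diag_mx (\row_k (if k == i then -1 else 1)).

Lemma S_mx_unit i j : i != j -> S_mx i j \in unitmx.
Proof.
move=> ij; suff /mulmx1_unit[] : S_mx i j *m (1%:M - 2 *: delta_mx i j) = 1%:M by [].
rewrite /S_mx mulmxBr mulmx1 mulmxDl mul1mx -scalemxAl -scalemxAr.
by rewrite mul_delta_mx_cond eq_sym (negbTE ij) mulr0n !scaler0 addr0 addrK.
Qed.

Lemma O_mx_unit i : O_mx i \in unitmx.
Proof.
rewrite unitmxE det_diag; apply: rpred_prod => k _.
by rewrite mxE; case: eqP.
Qed.

Lemma S_mx_ker i j (ij : i != j) : GLMx (S_mx_unit ij) \in ker_mod2.
Proof.
rewrite inE; apply/eqP/val_inj/matrixP => a b; rewrite !mxE /=.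
rewrite rmorphD rmorphM /= (_ : 2%:~R = 0 :> 'Z_2) ?mul0r ?addr0; last exact/val_inj.
by case: eqP.
Qed.

Lemma O_mx_ker i : GLMx (O_mx_unit i) \in ker_mod2.
Proof.
rewrite inE; apply/eqP/val_inj/matrixP => a b; rewrite !mxE /=.
case: (a =P b) => // _; case: eqP => // _; exact/val_inj.
Qed.

Definition Smat (i j : 'I_n) (ij : i != j) : Gamma2 := MkGamma2 (S_mx_ker ij).
Definition Omat (i : 'I_n) : Gamma2 := MkGamma2 (O_mx_ker i).

End Gamma2.

Section Presentation.
Variable n : nat.

Definition gens : finType :=
  ({ij : 'I_n * 'I_n | ij.1 != ij.2} + 'I_n)%type.

Definition gens_val (x : gens) : Gamma2 n :=
  match x with
  | inl ij => Smat (valP ij)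
  | inr i => Omat i
  end.

Definition gS (i j : 'I_n) (ij : i != j) : free_group gens :=
  free_gen (inl (exist _ (i, j) ij)).
Definition gO (i : 'I_n) : free_group gens := free_gen (inr i).

Inductive relator : free_group gens -> Prop :=
| Rel1 i :
    relator (gO i ^+ 2)
| Rel2 i j (_ : i != j) :
    relator (bracket (gO i) (gO j))
| Rel3 i j (ij : i != j) :
    relator ((gO i * gS ij) ^+ 2)
| Rel4 i j (ij : i != j) :
    relator ((gO j * gS ij) ^+ 2)
| Rel5 i j k (_ : i != j) (_ : i != k) (jk : j != k) :
    relator (bracket (gO i) (gS jk))
| Rel6 i j k (_ : i != j) (ki : k != i) (kj : k != j) :
    relator (bracket (gS ki) (gS kj))
| Rel7 i j k l (ij : i != j) (_ : i != k) (_ : i != l)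
      (_ : j != k) (_ : j != l) (kl : k != l) :
    relator (bracket (gS ij) (gS kl))
| Rel8 i j k (ji : j != i) (ki : k != i) (_ : j != k) :
    relator (bracket (gS ji) (gS ki))
| Rel9 i j k (kj : k != j) (ji : j != i) (ki : k != i) :
    relator (bracket (gS kj) (gS ji) * gS ki ^- 2)
| Rel10 i j k (ij : i != j) (ik : i != k) (ki : k != i)
      (ji : j != i) (jk : j != k) (kj : k != j) :
    relator ((gS ij * (gS ik)^-1 * gS ki * gS ji * gS jk * (gS kj)^-1) ^+ 2).

End Presentation.

(* Main.v *)
Require Import Defs.
From HB Require Import structures.
From mathcomp Require Import all_boot all_order all_algebra.
From mathcomp Require Import zify ring boolp.

(* Peak reduction. Let G be a group with elements S_ij, O_i satisfying the
   relators, mapped to Gamma_n[2] by rho, and fix an index k. The norm of g is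
   the l^1 norm of the k-th column of rho g, a vector with coprime entries whose
   k-th entry is the only odd one. Unless this vector is +-e_k, some S_ij^(+-1)
   lowers the norm: two nonzero entries differ in absolute value and the smaller
   one can be used to reduce the larger one. The relators show that any two
   lowering moves at g are joined by a path of generators whose vertices all have
   norm below that of g, and that an edge joining two vertices of equal norm can
   be pushed below that norm; signs are normalized by conjugating with the O_m.
   Hence every g with column e_k is reached from 1 through vertices of norm 1,
   that is, by generators stabilizing the line of e_k, and so g is a product
   u h O_k^e with u generated by the S_kj and h by generators avoiding k.
   Injectivity and surjectivity of rho on the subgroup generated by the S_ij, O_i
   with i, j in a set A follow by induction on A. Surjectivity is applied to
   G = Gamma_n[2] and injectivity to the presented group. *)

Set Implicit Arguments.
Unset Strict Implicit.
Unset Printing Implicit Defensive.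

Import Order.TTheory GRing.Theory Num.Theory.
Local Open Scope group_scope.
Local Open Scope quotient_scope.

(* [a, b] = c^2 as in a Heisenberg group, the shape of relator 9. *)
Definition chain_rel (G : groupType) (a b c : G) : Prop :=
  [/\ commute c a, commute c b & a * b = c * c * b * a].

Lemma chain_relC (G : groupType) (a b c : G) :
  chain_rel a b c -> chain_rel b a c^-1.
Proof.
move=> [ca cb E]; split; do ?exact/commute_sym/commuteV/commute_sym.
by rewrite -[RHS]mulgA E !mulgA mulgVK mulVg mul1g.
Qed.

Lemma chain_relV (G : groupType) (a b c : G) :
  chain_rel a b c -> chain_rel a^-1 b c^-1.
Proof.
move=> [ca cb E]; split.
- exact/commuteV/commute_sym/commuteV/commute_sym.
- exact/commute_sym/commuteV/commute_sym.
have cca : commute a^-1 (c * c) by apply: commuteM; exact/commute_sym/commuteV.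
apply: (mulgI (c * c)); rewrite !mulgA mulgK mulgV mul1g -cca.
by apply: (mulIg a); rewrite mulgVK -!mulgA (mulgA c) (mulgA _ b) -E mulKg.
Qed.

(** * Consequences of the relators, uniform in signs *)

Section Level2Model.

Variables (n : nat) (G : groupType) (f : gens n -> G).
Hypothesis f_rel : forall r, relator r -> free_lift f r = 1.

(** Total in [i] and [j], with default value 1 on the diagonal, so that terms carry no proof of
    [i != j]. *)
Definition Sgen i j : G :=
  if insub (i, j) is Some p then f (inl p) else 1.
Definition Ogen i : G := f (inr i).
Definition Spm i j (e : bool) : G := if e then Sgen i j else (Sgen i j)^-1.

Arguments Spm : simpl never.

Lemma lift_gS i j (ij : i != j) : free_lift f (gS ij) = Sgen i j.
Proof.
by rewrite free_lift_gen /Sgen insubT.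
Qed.

Lemma lift_gO i : free_lift f (gO i) = Ogen i.
Proof. exact: free_lift_gen. Qed.

Lemma TV i j e : (Spm i j e)^-1 = Spm i j (~~ e).
Proof. by case: e; rewrite /Spm //= invgK. Qed.

Lemma TK i j e : Spm i j (~~ e) * Spm i j e = 1.
Proof. by rewrite -TV mulVg. Qed.

Lemma commute_S_T i j k l e e' :
  commute (Sgen i j) (Sgen k l) -> commute (Spm i j e) (Spm k l e').
Proof.
by move=> c; case: e; case: e'; rewrite /Spm;
  do ?[exact: c | apply: commuteV | apply: commute_sym].
Qed.

Lemma bracket_eq1 (x y : G) : bracket x y = 1 -> commute x y.
Proof.
move=> h; apply: divg1_eq; rewrite invgM mulgA; exact: h.
Qed.

Lemma OO i : Ogen i * Ogen i = 1.
Proof. by have:= f_rel (Rel1 i); rewrite gmulfXn /= lift_gO. Qed.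

Lemma OV i : (Ogen i)^-1 = Ogen i.
Proof. by apply: mulg1_eq; exact: OO. Qed.

Lemma commute_OO i j : commute (Ogen i) (Ogen j).
Proof.
have [->|ij] := eqVneq i j; first exact: commute_refl.
apply: bracket_eq1; have:= f_rel (Rel2 ij).
by rewrite /bracket !(gmulfM, gmulfV) /= !lift_gO.
Qed.

(** Relators 3, 4 and 5 in one formula; this is what makes sign normalization by the [Ogen k]
    possible. *)
Lemma O_T_O i j k e : i != j ->
  Ogen k * Spm i j e * Ogen k = Spm i j (e (+) ((k == i) || (k == j))).
Proof.
move=> ij.
suff E : Ogen k * Sgen i j * Ogen k = Spm i j (~~ ((k == i) || (k == j))).
  case: e => //; have := congr1 (fun g => g^-1) E.
  by rewrite TV negbK !invgM OV mulgA.
have inv (g : G) : (Ogen k * g) ^+ 2 = 1 -> Ogen k * g * Ogen k = g^-1.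
  by rewrite expg2 !mulgA => /eqP; rewrite mulg_eq1 => /eqP.
case: (eqVneq k i) => [?|ki] /=; first subst k.
  by apply: inv; have:= f_rel (Rel3 ij); rewrite gmulfXn gmulfM /= lift_gO lift_gS.
case: (eqVneq k j) => [?|kj] /=; first subst k.
  by apply: inv; have:= f_rel (Rel4 ij); rewrite gmulfXn gmulfM /= lift_gO lift_gS.
have:= f_rel (Rel5 ki kj ij); rewrite /bracket !(gmulfM, gmulfV) /= lift_gO lift_gS.
by move/bracket_eq1=> ->; rewrite -mulgA OO mulg1.
Qed.

Lemma O_T i j k e : i != j ->
  Ogen k * Spm i j e = Spm i j (e (+) ((k == i) || (k == j))) * Ogen k.
Proof. by move=> ij; rewrite -O_T_O // -[RHS]mulgA OO mulg1. Qed.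

Lemma commute_row i j k e e' : k != i -> k != j ->
  commute (Spm k i e) (Spm k j e').
Proof.
move=> ki kj; apply: commute_S_T.
have [->|ij] := eqVneq i j; first exact: commute_refl.
apply: bracket_eq1; have:= f_rel (Rel6 ij ki kj).
by rewrite /bracket !(gmulfM, gmulfV) /= !lift_gS.
Qed.

Lemma commute_col i j k e e' : j != i -> k != i ->
  commute (Spm j i e) (Spm k i e').
Proof.
move=> ji ki; apply: commute_S_T.
have [->|jk] := eqVneq j k; first exact: commute_refl.
apply: bracket_eq1; have:= f_rel (Rel8 ji ki jk).
by rewrite /bracket !(gmulfM, gmulfV) /= !lift_gS.
Qed.

(** Relators 6, 7 and 8 together: equal row indices or equal column indices are allowed. *)
Lemma commute_disj i j k l e e' : i != j -> k != l -> i != l -> j != k ->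
  commute (Spm i j e) (Spm k l e').
Proof.
move=> ij kl il jk.
have [->|ik] := eqVneq i k; first by apply: commute_row; rewrite // eq_sym.
have [jl|jl] := eqVneq j l; first by rewrite -jl in kl *; apply: commute_col.
apply: commute_S_T; apply: bracket_eq1; have:= f_rel (Rel7 ij ik il jk jl kl).
by rewrite /bracket !(gmulfM, gmulfV) /= !lift_gS.
Qed.

(** Relator 9 for all four sign patterns, [e == e'] being the product of the signs. Inverting either
    factor of a chain inverts the third element, so all cases follow from the positive one. *)
Lemma T_chain k j i e e' : k != j -> j != i -> k != i ->
  Spm k j e * Spm j i e' =
  Spm k i (e == e') * Spm k i (e == e') * Spm j i e' * Spm k j e.
Proof.
move=> kj ji ki.
have E : chain_rel (Sgen k j) (Sgen j i) (Sgen k i).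
  split; [exact: (commute_row true true) | exact: (commute_col true true) |].
  have:= f_rel (Rel9 kj ji ki); rewrite /bracket !(gmulfM, gmulfV, gmulfXn) /=.
  by rewrite !lift_gS => /divg1_eq <-; rewrite !mulgVK.
have [_ _ ->//] : chain_rel (Spm k j e) (Spm j i e') (Spm k i (e == e')).
have:= chain_relC (chain_relV (chain_relC E)); rewrite !invgK => E'.
have:= chain_relV E'; rewrite invgK => E''.
by case: e e' => [] []; rewrite /Spm //=; exact: chain_relV.
Qed.


(** Conjugating the involution of relator 10 by [Ogen i] inverts the letters with index [i] and
    gives an involution [X * Y * Z]. Solving for the inverse of [X] yields [Y * Z * X * Y * Z]. *)
Lemma X_conj10 i j k : i != j -> i != k -> j != k ->
  Spm i j true * Spm i k false =
  Spm k i false * Spm j i false * (Spm j k true * Spm k j false) *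
    (Spm i j false * Spm i k true) *
    (Spm k i false * Spm j i false) * (Spm j k true * Spm k j false).
Proof.
move=> ij ik jk.
have ji : j != i by rewrite eq_sym.
have ki : k != i by rewrite eq_sym.
have kj : k != j by rewrite eq_sym.
have:= f_rel (Rel10 ij ik ki ji jk kj).
rewrite !(gmulfXn, gmulfM, gmulfV) /= !lift_gS expg2.
set V := _ * (Sgen k j)^-1 => VV.
pose X := Spm i j false * Spm i k true; pose Y := Spm k i false * Spm j i false.
pose Z := Spm j k true * Spm k j false.
have OV : Ogen i * V = X * Y * Z * Ogen i.
  rewrite /V -[Sgen i j]/(Spm i j true) -[(Sgen i k)^-1]/(Spm i k false).
  rewrite -[Sgen k i]/(Spm k i true) -[Sgen j i]/(Spm j i true) -[Sgen j k]/(Spm j k true).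
  rewrite -[(Sgen k j)^-1]/(Spm k j false) !mulgA.
  rewrite (O_T i true ij) eqxx /= -(mulgA _ (Ogen i)) (O_T i _ ik) eqxx /= !mulgA.
  rewrite -(mulgA _ (Ogen i)) (O_T i _ ki) eqxx orbT /= !mulgA.
  rewrite -(mulgA _ (Ogen i)) (O_T i _ ji) eqxx orbT /= !mulgA.
  rewrite -(mulgA _ (Ogen i)) (O_T i _ jk) (negbTE ij) (negbTE ik) /= !mulgA.
  rewrite -(mulgA _ (Ogen i)) (O_T i _ kj) (negbTE ij) (negbTE ik) /= !mulgA.
  by rewrite /X /Y /Z ?mulgA.
have W1 : X * (Y * Z * X * Y * Z) = 1.
  apply: (mulIg (Ogen i)); rewrite mul1g -[RHS]mulg1 -VV.
  by rewrite (mulgA (Ogen i)) OV -(mulgA _ (Ogen i)) OV !mulgA.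
have -> : Spm i j true * Spm i k false = X^-1.
  by rewrite /X invgM !TV; apply: commute_row.
by rewrite (mulg1_eq W1).
Qed.

End Level2Model.

(** * Entries of level 2 matrices: row operations and parity *)

Lemma intr_odd (R : nzRingType) (z : int) :
  (2 = 0 :> R)%R -> (z%:~R = (odd `|z|%N)%:R :> R)%R.
Proof.
move=> two0; have -> : (z%:~R = `|z|%N%:R :> R)%R.
  case: z => m //; rewrite NegzE abszN mulrNz; apply/eqP.
  by rewrite eq_sym -subr_eq0 opprK -mulr2n -(mulr_natr _ 2) two0 mulr0.
by rewrite -[in LHS](odd_double_half `|z|%N) natrD -muln2 natrM two0 mulr0 addr0.
Qed.

Section Gamma2Entries.
Variable n : nat.
Implicit Types g h : Gamma2 n.

Definition entry g r c : int := (g : 'M[int]_n) r c.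

Lemma entry1 r c : entry 1 r c = (r == c)%:R%R.
Proof. by rewrite /entry mxE. Qed.

Lemma entryM g h r c : entry (g * h) r c = (\sum_t entry g r t * entry h t c)%R.
Proof. by rewrite /entry mxE. Qed.

Lemma entry_inj g h : (forall r c, entry g r c = entry h r c) -> g = h.
Proof. by move=> E; do 2!apply: val_inj; apply/matrixP. Qed.

Lemma entry_Smat i j (ij : i != j) g r c :
  entry (Smat ij * g) r c =
  (entry g r c + (if r == i then 2 * entry g j c else 0))%R.
Proof.
rewrite /entry /= mulmxDl mul1mx -scalemxAl !mxE; congr (_ + _)%R.
case: eqP => [->|ri].
  rewrite (bigD1 j) //= mxE !eqxx mul1r big1 ?addr0 // => t tj.
  by rewrite mxE (negbTE tj) andbF mul0r.
by rewrite big1 ?mulr0 // => t _; rewrite mxE; case: eqP ri; rewrite // mul0r.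
Qed.

Lemma entry_Omat i g r c :
  entry (Omat i * g) r c = if r == i then (- entry g r c)%R else entry g r c.
Proof.
rewrite /entry /= mul_diag_mx !mxE; case: eqP => _; rewrite ?mulN1r ?mul1r //.
Qed.

Lemma odd_entry g r c : odd `|entry g r c|%N = (r == c).
Proof.
have /eqP/(congr1 (fun A : GLmx n 'Z_2 => (A : 'M__) r c)) := valP g.
rewrite /= !mxE /entry; move: ((g : 'M__) r c) => z.
rewrite intr_odd; last exact/val_inj.
by case: odd; case: (r == c).
Qed.

End Gamma2Entries.

(** * Normed paths *)

(** Only a submonoid in general; by [genV] a subgroup when [L] is closed under inversion. *)
Inductive gen (G : groupType) (L : G -> Prop) : G -> Prop :=
| gen1 : gen L 1
| genMl s g : L s -> gen L g -> gen L (s * g).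

Lemma gen_incl (G : groupType) (L : G -> Prop) s : L s -> gen L s.
Proof. by move=> Ls; rewrite -[s]mulg1; apply: genMl => //; apply: gen1. Qed.

Lemma genM (G : groupType) (L : G -> Prop) g h :
  gen L g -> gen L h -> gen L (g * h).
Proof.
by move=> Lg Lh; elim: Lg => [|s g' Ls _ IH]; rewrite ?mul1g // -mulgA; apply: genMl.
Qed.

Lemma genV (G : groupType) (L : G -> Prop) g :
  (forall s, L s -> L s^-1) -> gen L g -> gen L g^-1.
Proof.
move=> LV; elim=> [|s g' Ls _ IH]; first by rewrite invg1; apply: gen1.
by rewrite invgM; apply: genM => //; apply: gen_incl; apply: LV.
Qed.

Section Representation.

Variables (n : nat) (G : groupType) (f : gens n -> G).
Hypothesis f_rel : forall r, relator r -> free_lift f r = 1.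
Variable rho : G -> Gamma2 n.
Hypothesis rhoM : forall g h, rho (g * h) = rho g * rho h.
Hypothesis rho_f : forall a, rho (f a) = gens_val a.

Local Notation Spm := (Spm f).
Local Notation Ogen := (Ogen f).

Lemma rho1 : rho 1 = 1.
Proof. by apply: (mulgI (rho 1)); rewrite -rhoM !mulg1. Qed.

Lemma entry_T i j e g r c : i != j ->
  entry (rho (Spm i j e * g)) r c =
  (entry (rho g) r c +
   if r == i then (if e then 2 else -2) * entry (rho g) j c else 0)%R.
Proof.
move=> ij.
have ES h a : entry (rho (Sgen f i j * h)) a c =
    (entry (rho h) a c + if a == i then 2 * entry (rho h) j c else 0)%R.
  by rewrite rhoM /Sgen insubT rho_f /= -entry_Smat; congr (entry (_ * _) _ _);
    congr Smat; exact: bool_irrelevance.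
case: e; first by rewrite ES; case: eqP.
(* Write [g] as [S * (S^-1 * g)] and use the positive case; row [j] is unchanged since [i != j]. *)
rewrite -(mulVKg (Sgen f i j) g) /Spm mulKg !ES (eq_sym j) (negbTE ij) addr0.
by case: eqP => _; rewrite ?addr0 // mulNr addrK.
Qed.

Lemma entry_O i g r c : entry (rho (Ogen i * g)) r c =
  if r == i then (- entry (rho g) r c)%R else entry (rho g) r c.
Proof. by rewrite rhoM rho_f entry_Omat. Qed.

Inductive letter (A : {set 'I_n}) : G -> Prop :=
| LetterT i j e of i \in A & j \in A & i != j : letter A (Spm i j e)
| LetterO i of i \in A : letter A (Ogen i).

Lemma letterV A s : letter A s -> letter A s^-1.
Proof.
by case=> [i j e iA jA ij|i iA]; rewrite ?TV ?OV //; constructor.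
Qed.

(** * Paths controlled by the norm of one column *)

Section Column.

Variables (A : {set 'I_n}) (k : 'I_n).
Hypothesis kA : k \in A.

Definition coef g i : int := entry (rho g) i k.
Definition norm g : int := (\sum_i `|coef g i|)%R.

Ltac entries_lia :=
  repeat match goal with H : context [coef _ _] |- _ => revert H end;
  repeat match goal with
    | |- context [norm ?g] => generalize (norm g)
    | |- context [coef ?g ?i] => generalize (coef g i)
  end; clear; lia.

Lemma coefT i j e g m : i != j -> coef (Spm i j e * g) m =
  (coef g m + if m == i then (if e then 2 else -2) * coef g j else 0)%R.
Proof. exact: entry_T. Qed.

Lemma coefO i g m : coef (Ogen i * g) m = if m == i then (- coef g m)%R else coef g m.
Proof. exact: entry_O. Qed.

Lemma odd_coef g i : odd `|coef g i|%N = (i == k).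
Proof. exact: odd_entry. Qed.

Lemma norm_T i j e g : i != j ->
  norm (Spm i j e * g) = (norm g - `|coef g i| + `|coef (Spm i j e * g) i|)%R.
Proof.
move=> ij; rewrite /norm (bigD1 i) //= [in RHS](bigD1 i) //=.
rewrite (eq_bigr (fun m => `|coef g m|%R)) => [|m /negbTE mi]; first by ring.
by rewrite coefT // mi addr0.
Qed.

Lemma norm_O i g : norm (Ogen i * g) = norm g.
Proof. by apply: eq_bigr => m _; rewrite coefO; case: eqP => // _; rewrite normrN. Qed.

(** Row [k] of the inverse matrix times this column is 1, so a common divisor of the entries divides
    1. *)
Lemma coef_coprime g (d : int) : (forall i, d %| coef g i)%Z -> `|d|%N = 1%N.
Proof.
move=> dx; apply/eqP; rewrite -dvdn1.
have := entry1 k k; rewrite -rho1 -(mulVg g) rhoM entryM eqxx => E.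
have : (d %| 1)%Z by rewrite -[1%Z]E; apply: rpred_sum => t _; apply: dvdz_mull; exact: dx.
by rewrite dvdzE.
Qed.

(* The bound is imposed on edges only, so [g] itself may have norm [>= N]. *)
Inductive conn (N : int) (g : G) : G -> Prop :=
| conn_refl : conn N g g
| conn_step s h of letter A s & conn N g h & (norm h < N)%R & (norm (s * h) < N)%R :
    conn N g (s * h).

Lemma conn_trans N g h u : conn N g h -> conn N h u -> conn N g u.
Proof. by move=> gh; elim=> // s v Ls _ IH vN svN; exact: conn_step. Qed.

Lemma conn_sym N g h : conn N g h -> conn N h g.
Proof.
elim=> [|s v Ls _ IH vN svN]; first exact: conn_refl.
apply: conn_trans IH; rewrite -{2}(mulKg s v); apply: conn_step => //.
- exact: letterV.
- exact: conn_refl.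
- by rewrite mulKg.
Qed.

Lemma conn_eq N g h : g = h -> conn N g h.
Proof. by move->; apply: conn_refl. Qed.

Lemma conn_head N g h s : letter A s -> (norm g < N)%R -> (norm (s * g) < N)%R ->
  conn N (s * g) h -> conn N g h.
Proof.
by move=> Ls gN sgN; apply: conn_trans; apply: conn_step => //; exact: conn_refl.
Qed.

Lemma conn_headT N g h i j e : i \in A -> j \in A -> i != j ->
  (norm g < N)%R -> (norm (Spm i j e * g) < N)%R -> conn N (Spm i j e * g) h ->
  conn N g h.
Proof. by move=> iA jA ij; apply: conn_head; constructor. Qed.

(** [Ogen m] preserves the norm, so one [Ogen m] edge is added at each end of the given path. *)
Lemma conn_O N g h m : m \in A -> (norm g < N)%R -> (norm h < N)%R ->
  conn N (Ogen m * g) (Ogen m * h) -> conn N g h.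
Proof.
move=> mA gN hN c; apply: (@conn_head _ _ _ (Ogen m)); rewrite ?norm_O //.
  exact: LetterO.
apply: conn_trans c _; apply: conn_sym; apply: (@conn_head _ _ _ (Ogen m)); rewrite ?norm_O //.
  exact: LetterO.
exact: conn_refl.
Qed.

(** * Joining two lowering moves at a vertex with nonnegative column *)

Definition lowers g i j : Prop :=
  [/\ i \in A, j \in A, i != j & (0 < coef g j < coef g i)%R].

(** The new entry [coef g i - 2 * coef g j] lies strictly between [- coef g i] and [coef g i]. *)
Lemma lowersN g i j : lowers g i j -> (norm (Spm i j false * g) < norm g)%R.
Proof. case=> _ _ ij xij; rewrite norm_T // coefT // eqxx; entries_lia. Qed.

(** Neither move changes an entry that the other one uses, so the two commute and the fourth vertex
    of the square is lower still. *)
Lemma conn_commute g i j p q : lowers g i j -> lowers g p q ->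
  i != p -> i != q -> j != p ->
  conn (norm g) (Spm i j false * g) (Spm p q false * g).
Proof.
move=> lij lpq ip iq jp; have := lij => -[iA jA ij xij]; have := lpq => -[pA qA pq xpq].
apply: (@conn_headT _ _ _ p q false) => //; first exact: lowersN.
  rewrite !(norm_T, coefT) // !eqxx (eq_sym p) (negbTE ip) (eq_sym q) (negbTE iq); entries_lia.
apply: conn_sym; apply: (@conn_headT _ _ _ i j false) => //; first exact: lowersN.
  rewrite !(norm_T, coefT) // !eqxx (negbTE ip) (negbTE jp); entries_lia.
by apply: conn_eq; rewrite !mulgA; congr (_ * _); apply: commute_disj.
Qed.

(* The detour through [Spm j l] avoids the large entry [coef i - 2 (coef j + coef l)]. *)
Lemma conn_row_gt g i j l : lowers g i j -> lowers g i l -> (coef g l < coef g j)%R ->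
  conn (norm g) (Spm i j false * g) (Spm i l false * g).
Proof.
move=> lij lil xlj; have := lij => -[iA jA ij xij]; have := lil => -[_ lA il xil].
have jl : j != l by apply: contraTneq xlj => ->; rewrite ltxx.
have [ji li lj] : [/\ j != i, l != i & l != j] by split; rewrite eq_sym.
have sgs := (eqxx, negbTE ij, negbTE il, negbTE jl, negbTE ji, negbTE li, negbTE lj).
apply: conn_sym.
apply: (@conn_headT _ _ _ j l false) => //.
- exact: lowersN.
- rewrite !(norm_T, coefT) // !sgs; entries_lia.
apply: (@conn_headT _ _ _ i j false) => //.
- rewrite !(norm_T, coefT) // !sgs; entries_lia.
- rewrite !(norm_T, coefT) // !sgs; entries_lia.
apply: (@conn_headT _ _ _ i l false) => //.
- rewrite !(norm_T, coefT) // !sgs; entries_lia.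
- rewrite !(norm_T, coefT) // !sgs; entries_lia.
apply: (@conn_headT _ _ _ j l true) => //.
- rewrite !(norm_T, coefT) // !sgs; entries_lia.
- rewrite !(norm_T, coefT) // !sgs; entries_lia.
(* By relator 9, [S_jl S_il^-1 S_ij^-1 S_jl^-1 S_il^-1] equals [S_ij^-1]. *)
apply: conn_eq; rewrite !mulgA; congr (_ * _).
rewrite -(mulgA _ (Spm i j false)) (T_chain f_rel _ _ ij jl il) !mulgA.
rewrite -(TV f i l true) mulgVK (commute_col f_rel true true jl il) (TV f i l true).
rewrite -(TV f j l true) mulgK.
by rewrite -(TV f i l true) (commute_row f_rel true false il ij) mulgK.
Qed.

(** One edge of a path moving only three entries: the new entries [a], [b], [c] are checked, both
    ends are bounded, and the new vertex is generalized to keep terms small. *)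
Ltac step3 i j l co sgs ab N p q e a b c :=
  match goal with |- conn _ ?g _ =>
    let co' := fresh in let g' := fresh in
    let ei := fresh in let ej := fresh in let el := fresh in let en := fresh in
    have co' : coords3 i j l (Spm p q e * g) a b c N;
    [ case: co => [ei ej el en]; split; rewrite ?(norm_T, coefT) // !sgs
          ?ei ?ej ?el ?en; clear; lia
    | apply: (@conn_headT _ g _ p q e) => //;
      [ case: co => _ _ _ ->; move: ab; clear; lia
      | case: co' => _ _ _ ->; move: ab; clear; lia
      | move: {co} (Spm p q e * g) co' => g' co ]
    ]
  end.

(** For distinct [i], [j], [l], [N] is the contribution of the remaining entries, constant under
    moves among these three indices. *)
Definition coords3 i j l g (a b c N : int) : Prop :=
  [/\ coef g i = a, coef g j = b, coef g l = c & norm g = N + `|a| + `|b| + `|c|]%R.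

(* Relator 10: the two lowering moves at entries [(a + 2 b, b, b)] lead to states
   with the same entries [(a, b, b)]. *)
Lemma conn_X_conj10 i j l g (a b N M : int) :
  i \in A -> j \in A -> l \in A -> i != j -> i != l -> j != l ->
  coords3 i j l g a b b N -> (- b < a < 0)%R -> (M = N + a + 4 * b)%R ->
  conn M g (Spm i j true * (Spm i l false * g)).
Proof.
move=> iA jA lA ij il jl co ab ->.
have [ji li lj] : [/\ j != i, l != i & l != j] by split; rewrite eq_sym.
have sgs := (eqxx, negbTE ij, negbTE il, negbTE jl, negbTE ji, negbTE li, negbTE lj).
have -> : Spm i j true * (Spm i l false * g) =
   Spm l i false * (Spm j i false * (Spm j l true * (Spm l j false *
     (Spm i j false * (Spm i l true * (Spm l i false * (Spm j i false *
       (Spm j l true * (Spm l j false * g))))))))).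
  by rewrite !mulgA X_conj10 // !mulgA.
(* The ten letters of the word are applied from the right. Each vertex stays below [N + a + 4 * b],
   the norm for the entries [(a + 2 b, b, b)]. *)
step3 i j l co sgs ab N l j false a%R b%R (- b)%R.
step3 i j l co sgs ab N j l true a%R (- b)%R (- b)%R.
step3 i j l co sgs ab N j i false a%R (- b - 2 * a)%R (- b)%R.
step3 i j l co sgs ab N l i false a%R (- b - 2 * a)%R (- b - 2 * a)%R.
step3 i j l co sgs ab N i l true (- 3 * a - 2 * b)%R (- b - 2 * a)%R (- b - 2 * a)%R.
step3 i j l co sgs ab N i j false a%R (- b - 2 * a)%R (- b - 2 * a)%R.
step3 i j l co sgs ab N l j false a%R (- b - 2 * a)%R (b + 2 * a)%R.
step3 i j l co sgs ab N j l true a%R (b + 2 * a)%R (b + 2 * a)%R.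
step3 i j l co sgs ab N j i false a%R b%R (b + 2 * a)%R.
step3 i j l co sgs ab N l i false a%R b%R b%R.
by apply: conn_refl.
Qed.
Lemma conn_row_eq g i j l : lowers g i j -> lowers g i l -> j != l ->
  coef g j = coef g l -> (coef g i < 2 * coef g j)%R ->
  conn (norm g) (Spm i j false * g) (Spm i l false * g).
Proof.
move=> [iA jA ij xij] [_ lA il _] jl xjl xij2.
have -> : Spm i l false * g = Spm i j true * (Spm i l false * (Spm i j false * g)).
  by rewrite !mulgA (commute_row f_rel _ _ ij il) -(mulgA _ (Spm i j true)) (TK f i j false) mulg1.
apply: (@conn_X_conj10 i j l _ (coef g i - 2 * coef g j) (coef g j) (norm g - coef g i - 2 * coef g j))%R => //.
- split; rewrite ?(norm_T, coefT) // ?eqxx.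
  + entries_lia.
  + rewrite (eq_sym j) (negbTE ij); entries_lia.
  + rewrite (eq_sym l) (negbTE il) -xjl; entries_lia.
  + entries_lia.
- entries_lia.
- entries_lia.
Qed.

Lemma conn_row g i j l : (forall m, 0 <= coef g m)%R ->
  lowers g i j -> lowers g i l -> conn (norm g) (Spm i j false * g) (Spm i l false * g).
Proof.
move=> x0 lij lil; have [->|jl] := eqVneq j l; first exact: conn_refl.
have := lij => -[iA jA ij xij]; have := lil => -[_ lA il xil].
have [ji li lj] : [/\ j != i, l != i & l != j] by split; rewrite eq_sym.
case: (ltgtP (coef g j) (coef g l)) => xjl; first exact/conn_sym/conn_row_gt.
  exact: conn_row_gt.
(* Equal entries at two different indices are even, because only the entry at [k] is odd. *)
have odd_j : odd `|coef g j|%N = (j == k) by exact: odd_coef.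
have odd_l : odd `|coef g l|%N = (l == k) by exact: odd_coef.
have jk : j != k.
  by apply/negP => jk; move: odd_l jl; rewrite -xjl odd_j jk (eqP jk) eq_sym => <-.
have lk : l != k by rewrite -odd_l -xjl odd_j.
have odd_i : odd `|coef g i|%N = (i == k) by exact: odd_coef.
have [ik|ik] := eqVneq i k.
  rewrite (negbTE jk) in odd_j; rewrite ik eqxx -ik in odd_i.
  case: (ltrP (coef g i) (2 * coef g j)%R) => xij2; first exact: conn_row_eq.
  (* The entry at [i] is odd, hence greater than [2 * coef g j], and the commuting square stays
     low. *)
  apply: (@conn_headT _ _ _ i l false) => //; first exact: lowersN.
    by rewrite !(norm_T, coefT) // !eqxx (negbTE li); entries_lia.
  apply: conn_sym; apply: (@conn_headT _ _ _ i j false) => //; first exact: lowersN.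
    by rewrite !(norm_T, coefT) // !eqxx (negbTE ji); entries_lia.
  by apply: conn_eq; rewrite !mulgA; congr (_ * _); apply: commute_row.
(* For [i != k] the odd entry at [k] differs from the even [coef g j]. If it is smaller, the route
   passes through [Spm i k false * g]; if larger, through [Spm k j false * g]. *)
have odd_k : odd `|coef g k|%N by rewrite odd_coef eqxx.
rewrite (negbTE jk) in odd_j.
have xk0 := x0 k.
case: (ltrP (coef g k) (coef g j)) => xkj.
  have lik : lowers g i k by split=> //; entries_lia.
  apply: (@conn_trans _ _ (Spm i k false * g)); first exact: conn_row_gt.
  by apply/conn_sym/conn_row_gt => //; rewrite -xjl.
have lkj : lowers g k j by split; rewrite // 1?eq_sym //; entries_lia.
have lkl : lowers g k l by split; rewrite // 1?eq_sym //; entries_lia.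
apply: (@conn_trans _ _ (Spm k j false * g)).
  by apply: conn_commute.
by apply: conn_commute; rewrite // eq_sym.
Qed.

(** Since [coef g l < coef g j < coef g i], the move [Spm i l false] lowers too; it shares its row
    with one given move and its column with the other. *)
Lemma conn_chain g i j l : (forall m, 0 <= coef g m)%R ->
  lowers g i j -> lowers g j l -> conn (norm g) (Spm i j false * g) (Spm j l false * g).
Proof.
move=> x0 lij ljl; have := lij => -[iA jA ij xij]; have := ljl => -[_ lA jl xjl].
have il : i != l by apply: contraTneq xij => ->; entries_lia.
have lil : lowers g i l by split=> //; entries_lia.
apply: (@conn_trans _ _ (Spm i l false * g)); first exact: conn_row.
by apply: conn_commute; rewrite // eq_sym.
Qed.

Lemma conn_lowers g i j p q : (forall m, 0 <= coef g m)%R ->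
  lowers g i j -> lowers g p q -> conn (norm g) (Spm i j false * g) (Spm p q false * g).
Proof.
move=> x0 lij lpq; have [?|ip] := eqVneq i p; first by subst p; apply: conn_row.
have [?|iq] := eqVneq i q; first by subst q; apply/conn_sym/conn_chain.
have [?|jp] := eqVneq j p; first by subst p; apply: conn_chain.
exact: conn_commute.
Qed.

(** * Descents for columns with arbitrary signs *)

Definition supported g : Prop := forall i, i \notin A -> coef g i = 0%R.

Lemma supported_letter s g : letter A s -> supported g -> supported (s * g).
Proof.
case=> [i j e iA jA ij|i iA] sg m mA; rewrite ?coefT // ?coefO sg // ?oppr0 ?if_same //.
by case: eqP mA => [->|_]; rewrite ?iA.
Qed.

(* Left multiplication by [Ogen m] flips the sign of the [m]-th entry. *)
Lemma nonneg_ind (P : G -> Prop) :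
  (forall g m, m \in A -> P (Ogen m * g) -> P g) ->
  (forall g, supported g -> (forall i, 0 <= coef g i)%R -> P g) ->
  forall g, supported g -> P g.
Proof.
move=> PO P0 g.
(* Induction on the number of negative entries. *)
elim: {g}#|_|.+1 {-2}g (ltnSn #|[set i | (coef g i < 0)%R]|) => // N IH g gN sg.
case: (pickP (fun i => coef g i < 0)%R) => [i xi|x0]; last first.
  by apply: P0 => // i; rewrite leNgt x0.
have iA : i \in A by apply: contraTT xi => /sg ->.
apply: (PO g i iA); apply: IH; last by apply: supported_letter => //; constructor.
rewrite ltnS in gN; apply: leq_trans gN; apply: proper_card; apply/properP; split.
  apply/subsetP => m; rewrite !inE coefO; case: eqP => // ->; entries_lia.
by exists i; rewrite !inE ?coefO ?eqxx //; entries_lia.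
Qed.

Definition descent g t : Prop :=
  exists i j e, [/\ i \in A, j \in A, i != j, t = Spm i j e & (norm (t * g) < norm g)%R].

Lemma descent_letter g t : descent g t -> letter A t.
Proof. by case=> i [j [e [iA jA ij -> _]]]; constructor. Qed.

Lemma descent_lt g t : descent g t -> (norm (t * g) < norm g)%R.
Proof. by case=> i [j [e []]]. Qed.

Lemma descent_nonneg g t : (forall m, 0 <= coef g m)%R -> descent g t ->
  exists i j, lowers g i j /\ t = Spm i j false.
Proof.
move=> x0 [i [j [e [iA jA ij ->]]]]; rewrite norm_T // coefT // eqxx.
have := x0 i; have := x0 j; case: e => xj xi lt; first by exfalso; entries_lia.
by exists i, j; split=> //; split=> //; entries_lia.
Qed.

Lemma lowers_descent g i j : lowers g i j -> descent g (Spm i j false).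
Proof. by move=> l; have [iA jA ij _] := l; exists i, j, false; split=> //; apply: lowersN. Qed.

Lemma OKg m g : Ogen m * (Ogen m * g) = g.
Proof. by rewrite mulgA OO // mul1g. Qed.

Lemma descent_O m g t : m \in A -> descent g t -> descent (Ogen m * g) (Ogen m * t * Ogen m).
Proof.
move=> mA [i [j [e [iA jA ij -> lt]]]].
exists i, j, (e (+) ((m == i) || (m == j))); rewrite O_T_O //; split=> //.
by rewrite mulgA -O_T // -mulgA !norm_O.
Qed.

Definition confluent g : Prop := forall t t',
  descent g t -> descent g t' -> conn (norm g) (t * g) (t' * g).

Lemma confluentP g : supported g -> confluent g.
Proof.
move: g; apply: nonneg_ind => [g m mA c t t' dt dt'|g _ x0 t t'].
  apply: (@conn_O _ _ _ m); rewrite ?descent_lt //.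
  have := c _ _ (descent_O mA dt) (descent_O mA dt').
  by rewrite -!mulgA !OKg norm_O.
move=> /(descent_nonneg x0)[i [j [lij ->]]] /(descent_nonneg x0)[p [q [lpq ->]]].
exact: conn_lowers.
Qed.

(** A nonzero entry off [k] is even and so differs in absolute value from the odd one at [k]: the
    smaller reduces the larger. If no such entry exists, coprimality forces norm 1. *)
Lemma descent_exists g : supported g -> (1 < norm g)%R -> exists t, descent g t.
Proof.
move: g; apply: nonneg_ind => [g m mA IH|g sg x0] gN.
  by case: IH => [|t /(descent_O mA)]; rewrite ?norm_O // OKg => dt; exists (Ogen m * t * Ogen m).
suff [i [j /lowers_descent lij]] : exists i j, lowers g i j by exists (Spm i j false).
have odd_k : odd `|coef g k|%N by rewrite odd_coef eqxx.
have xk0 := x0 k.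
case: (pickP (fun i => (i != k) && (coef g i != 0)%R)) => [i /andP[ik xi]|all0].
  have iA : i \in A by apply: contraNT xi => /sg ->.
  have odd_i : odd `|coef g i|%N = false by rewrite odd_coef (negbTE ik).
  have xi0 := x0 i.
  case: (ltrP (coef g i) (coef g k)) => xik; [exists k, i | exists i, k]; split=> //.
  - by rewrite eq_sym.
  - entries_lia.
  - entries_lia.
have x0' i : i != k -> coef g i = 0%R.
  by move=> ik; have := all0 i; rewrite ik /= => /negbFE/eqP.
have xk1 : `|coef g k|%N = 1%N.
  by apply: (@coef_coprime g) => i; have [->//|ik] := eqVneq i k; rewrite x0' // dvdz0.
move: gN; rewrite /norm (bigD1 k) //= big1 ?addr0; last by move=> i /x0' ->; rewrite normr0.
by move=> xk2; exfalso; entries_lia.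
Qed.

(** * Edges between vertices of equal norm *)

Definition flat g : Prop := forall i j e, i \in A -> j \in A -> i != j ->
  norm (Spm i j e * g) = norm g ->
  exists t t', [/\ descent g t, descent (Spm i j e * g) t' &
    conn (norm g) (t * g) (t' * (Spm i j e * g))].

Lemma flat_O g m : m \in A -> flat (Ogen m * g) -> flat g.
Proof.
move=> mA c i j e iA jA ij gN.
have [|t [t' [dt dt']]] := c i j (e (+) ((m == i) || (m == j))) iA jA ij.
  by rewrite mulgA -O_T // -mulgA !norm_O.
move: dt'; rewrite mulgA -O_T // -mulgA norm_O => dt' ct.
exists (Ogen m * t * Ogen m), (Ogen m * t' * Ogen m); split.
- by rewrite -{1}(OKg m g); apply: descent_O.
- by rewrite -{1}(OKg m (Spm i j e * g)); apply: descent_O.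
have := descent_lt dt; have := descent_lt dt'; rewrite !norm_O gN => lt' lt.
by apply: (@conn_O _ _ _ m); rewrite ?norm_O -?mulgA ?OKg ?norm_O.
Qed.

Lemma flatP g : supported g -> (1 < norm g)%R -> flat g.
Proof.
move: g; apply: nonneg_ind => [g m mA IH gN|g sg x0 gN i j e iA jA ij].
  by apply: (flat_O mA); apply: IH; rewrite norm_O.
have [ji xi0 xj0] : [/\ j != i, 0 <= coef g i & 0 <= coef g j]%R by rewrite eq_sym.
have lowersV t : descent g t -> exists p q, lowers g p q by move=> /(descent_nonneg x0)[p [q []]]; exists p, q.
(* If the entry at [j] is zero, the edge leaves the column unchanged, and any descent at [g] is also
   one at the other end. *)
have [xj|xj gTN] := eqVneq (coef g j) 0%R.
  move=> gTN; have [t /lowersV[p [q lpq]]] := descent_exists sg gN.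
  have := lpq => -[pA qA pq xpq].
  have jp : j != p by apply: contraTneq xpq => <-; entries_lia.
  have jq : j != q by apply: contraTneq xpq => <-; entries_lia.
  have [pj qj qp] : [/\ p != j, q != j & q != p] by split; rewrite eq_sym.
  have xT_j h a c : a != j -> coef h j = 0%R -> coef (Spm a j c * h) =1 coef h.
    by move=> aj hj m; rewrite coefT // hj mulr0 if_same addr0.
  have norm_T_j h a c : a != j -> coef h j = 0%R -> norm (Spm a j c * h) = norm h.
    by move=> aj hj; apply: eq_bigr => m _; rewrite xT_j.
  have d : descent g (Spm p q false) by exact: lowers_descent.
  have d' : descent (Spm i j e * g) (Spm p q false).
    apply: lowers_descent; split; rewrite // !xT_j //.
  exists (Spm p q false), (Spm p q false); split=> //.
  have pgj : coef (Spm p q false * g) j = 0%R by rewrite coefT // (negbTE jp) addr0.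
  have lt := descent_lt d.
  apply: (@conn_headT _ _ _ i j e) => //; first by rewrite norm_T_j.
  have [iq|iq] := eqVneq i q; last first.
    by apply: conn_eq; rewrite !mulgA; congr (_ * _); apply: commute_disj; rewrite // eq_sym.
  (* For [q = i] the descent and the edge do not commute; relator 9 corrects this by two letters in
     column [j], which cost nothing as the entry at [j] is zero. *)
  subst q.
  have pgj' : coef (Spm i j e * (Spm p i false * g)) j = 0%R by rewrite xT_j.
  have pgj'' c : coef (Spm p j c * (Spm i j e * (Spm p i false * g))) j = 0%R by rewrite xT_j.
  apply: (@conn_headT _ _ _ p j (false == e)) => //; do ?by rewrite !norm_T_j.
  apply: (@conn_headT _ _ _ p j (false == e)) => //; do ?by rewrite !norm_T_j.
  by apply: conn_eq; rewrite !mulgA (T_chain f_rel _ _ pq ij pj).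
(* With a nonzero entry at [j], the norm is kept only by reflecting:
   [coef g i - 2 * coef g j = - coef g i]. *)
have [exij e0] : coef g i = coef g j /\ e = false.
  move: gTN; rewrite norm_T // coefT // eqxx.
  by case: (e) => gTN; split=> //; entries_lia.
subst e.
have odd_i : odd `|coef g i|%N = (i == k) by exact: odd_coef.
have odd_j : odd `|coef g j|%N = (j == k) by exact: odd_coef.
have ik : i != k.
  by apply/negP => ik; move: odd_j ij; rewrite -exij odd_i ik (eqP ik) eq_sym => <-.
have jk : j != k by rewrite -odd_j -exij odd_i.
have [ki kj] : k != i /\ k != j by split; rewrite eq_sym.
have odd_k : odd `|coef g k|%N by rewrite odd_coef eqxx.
have xk0 := x0 k; rewrite (negbTE jk) in odd_j.
have sgs := (eqxx, negbTE ij, negbTE ik, negbTE jk, negbTE ji, negbTE ki, negbTE kj).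
case: (ltrP (coef g k) (coef g j)) => xkj.
  have d : descent g (Spm j k false) by apply: lowers_descent; split=> //; entries_lia.
  exists (Spm j k false), (Spm j k false); split=> //.
    exists j, k, false; split=> //; rewrite !(norm_T, coefT) // !sgs; entries_lia.
  (* The two letters [Spm i k false] required by relator 9 are placed on both sides of
     [Spm i j false], which keeps the entry at [i] small. *)
  apply: (@conn_headT _ _ _ i k false) => //; first exact: descent_lt.
    rewrite !(norm_T, coefT) // !sgs; entries_lia.
  apply: (@conn_headT _ _ _ i j false) => //.
  - rewrite !(norm_T, coefT) // !sgs; entries_lia.
  - rewrite !(norm_T, coefT) // !sgs; entries_lia.
  apply: (@conn_headT _ _ _ i k false) => //.
  - rewrite !(norm_T, coefT) // !sgs; entries_lia.
  - rewrite !(norm_T, coefT) // !sgs; entries_lia.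
  apply: conn_eq; rewrite !mulgA; congr (_ * _).
  rewrite -(mulgA (Spm i k false)) (commute_row f_rel false false ij ik) mulgA.
  rewrite -(mulgA _ (Spm i j false)) (T_chain f_rel _ _ ij jk ik) !mulgA.
  by rewrite -(TV f i k true) mulgVK mulVg mul1g.
have lkj : lowers g k j by split=> //; entries_lia.
exists (Spm k j false), (Spm k j false); split; first exact: lowers_descent.
  apply: lowers_descent; split=> //; rewrite !coefT // !sgs; entries_lia.
apply: (@conn_headT _ _ _ i j false) => //; first exact: lowersN.
  rewrite !(norm_T, coefT) // !sgs; entries_lia.
by apply: conn_eq; rewrite !mulgA; congr (_ * _); apply: commute_col.
Qed.

(** * Lowering the bound on a path *)

(* The vertices by which [g] may be replaced to bring a path below level [N]. *)
Definition low (N : int) g h : Prop :=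
  (norm g < N)%R /\ h = g \/ norm g = N /\ exists t, descent g t /\ h = t * g.

Lemma low_exists N g : supported g -> (1 < N)%R -> (norm g <= N)%R ->
  exists h, low N g h.
Proof.
move=> sg N1; rewrite le_eqVlt => /orP[/eqP gN|gN]; last by exists g; left.
by have [|t dt] := descent_exists sg; [rewrite gN | exists (t * g); right; eauto].
Qed.

(** If one end has norm [N] and the other is lower, the edge is itself a descent and confluence
    applies. If both have norm [N], use [flatP] for an [Spm] edge, and conjugation of the descent
    for an [Ogen] edge. *)
Lemma conn_low N s g h h' : (1 < N)%R -> letter A s -> supported g ->
  (norm g <= N)%R -> (norm (s * g) <= N)%R -> low N g h -> low N (s * g) h' ->
  conn N h h'.
Proof.
move=> N1 Ls sg gN sgN lg lsg; have ssg := supported_letter Ls sg.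
case: lg => [[{}gN ->]|[{}gN [t [dt ->]]]].
  case: lsg => [[{}sgN ->]|[{}sgN [t [dt ->]]]].
    by apply: conn_head Ls gN sgN _; exact: conn_refl.
  case: Ls sgN dt ssg => [i j e iA jA ij|i iA] sgN dt ssg; last first.
    by move: gN; rewrite -sgN norm_O ltxx.
  have TTg : Spm i j (~~ e) * (Spm i j e * g) = g by rewrite mulgA TK mul1g.
  rewrite -{1}TTg -sgN; apply: confluentP => //.
  by exists i, j, (~~ e); split=> //; rewrite TTg sgN.
case: lsg => [[{}sgN ->]|[{}sgN [t' [dt' ->]]]].
  case: Ls sgN ssg => [i j e iA jA ij|i iA] sgN ssg; last first.
    by move: sgN; rewrite norm_O gN ltxx.
  rewrite -gN in sgN *; apply: confluentP => //.
  by exists i, j, e; split.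
case: Ls sgN ssg dt' => [i j e iA jA ij|i iA] sgN ssg dt'.
  have [||d [d' [dd dd' c]]] := @flatP g sg _ i j e iA jA ij; rewrite ?gN //.
  apply: (@conn_trans _ _ (d * g)); first by rewrite -gN; apply: confluentP.
  rewrite gN in c; apply: (conn_trans c).
  by rewrite -sgN; apply: confluentP.
have dO := descent_O iA dt.
apply: (@conn_head _ _ _ (Ogen i)); first exact: LetterO.
- by rewrite -gN descent_lt.
- by rewrite norm_O -gN descent_lt.
have -> : Ogen i * (t * g) = (Ogen i * t * Ogen i) * (Ogen i * g) by rewrite -!mulgA OKg.
by rewrite -sgN; apply: confluentP.
Qed.

(** Each vertex of norm [N] is replaced by a lower one, and [conn_low] joins the replacements of
    neighbours. The induction runs over all [low] replacements of the current end, which may itself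
    have norm [N]. *)
Lemma conn_lower N g h : (1 < N)%R -> supported g -> (norm g < N)%R ->
  (norm h < N)%R -> conn (N + 1) g h -> conn N g h.
Proof.
move=> N1 sg gN hN c.
suff [_ [_]] : supported h /\ ((norm h <= N)%R /\ forall h', low N h h' -> conn N g h').
  by apply; left.
elim: c {hN} => [|s v Ls _ [sv [vN IH]] vN1 svN1].
  split=> //; split=> [|h' [[_ ->]|[gN' _]]]; first exact: ltW.
    exact: conn_refl.
  by rewrite gN' ltxx in gN.
have svN : (norm (s * v) <= N)%R by rewrite -ltzD1.
split; first exact: supported_letter.
split=> // h' lh'; have [u lu] := low_exists sv N1 vN.
apply: conn_trans (IH _ lu) _; exact: conn_low lu lh'.
Qed.

Lemma coef1 i : coef 1 i = (i == k)%:R%R.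
Proof. by rewrite /coef rho1 entry1. Qed.

Lemma norm1 : norm 1 = 1%R.
Proof.
rewrite /norm (bigD1 k) //= coef1 eqxx big1 ?addr0 // => i /negbTE ik.
by rewrite coef1 ik.
Qed.

Lemma supported1 : supported 1.
Proof. by move=> i iA; rewrite coef1; case: eqP iA => // ->; rewrite kA. Qed.

Lemma conn_mono N M g h : (N <= M)%R -> conn N g h -> conn M g h.
Proof.
move=> NM; elim=> [|s v Ls _ IH vN svN]; first exact: conn_refl.
by apply: conn_step => //; apply: lt_le_trans NM.
Qed.

(** A word for [g] traces a path from 1 with some bound [2 + m], which is then lowered one unit at a
    time. *)
Lemma gen_conn g : gen (letter A) g -> norm g = 1%R -> conn 2 1 g.
Proof.
move=> Lg g1.
have [m] : exists m, conn (2 + m%:Z)%R 1 g.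
  elim: Lg {g1} => [|s h Ls _ [m IH]]; first by exists 0%N; apply: conn_refl.
  exists (m + `|norm h| + `|norm (s * h)|)%N.
  apply: conn_step => //; first by apply: conn_mono IH; entries_lia.
    entries_lia.
  entries_lia.
elim: m => [|m IH] c; first by move: c; rewrite addr0.
apply: IH; apply: conn_lower; rewrite ?norm1 ?g1 //; do ?by clear; lia.
  exact: supported1.
by have -> : (2 + m%:Z + 1 = 2 + m.+1%:Z)%R by clear; lia.
Qed.

End Column.

(** * Stabilizer of a basis vector and induction on the index set *)

Definition row_letter k (B : {set 'I_n}) s : Prop :=
  exists j e, [/\ j \in B, k != j & s = Spm k j e].

Lemma gen_sub (L L' : G -> Prop) g :
  (forall s, L s -> gen L' s) -> gen L g -> gen L' g.
Proof. by move=> LL'; elim=> [|s h Ls _ IH]; [apply: gen1 | apply: genM => //; apply: LL']. Qed.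

Lemma letter_gen_set0 g : gen (letter set0) g -> g = 1.
Proof. by elim=> // s h [i j e|i]; rewrite inE. Qed.

Lemma entry_row_gen k B u r c : gen (row_letter k B) u -> r != k ->
  entry (rho u) r c = (r == c)%:R%R.
Proof.
move=> Lu /negbTE rk; elim: Lu => [|s h [j [e [_ kj ->]]] _ IH].
  by rewrite rho1 entry1.
by rewrite entry_T // rk addr0.
Qed.

Lemma entry_row_gen_off k B u j : gen (row_letter k B) u -> j \notin B ->
  entry (rho u) k j = (k == j)%:R%R.
Proof.
move=> Lu jB; elim: Lu => [|s h [m [e [mB km ->]]] Lh IH].
  by rewrite rho1 entry1.
rewrite entry_T // eqxx IH (entry_row_gen _ Lh) 1?eq_sym //.
have /negbTE -> : m != j by apply: contraTneq mB => ->.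
by rewrite mulr0 addr0.
Qed.

Lemma entry_row_genM k B u g r : gen (row_letter k B) u ->
  (forall r', r' != k -> entry (rho g) r' k = 0%R) ->
  entry (rho (u * g)) r k = entry (rho g) r k.
Proof.
move=> Lu g0; elim: Lu r => [|s h [j [e [_ kj ->]]] _ IH] r; first by rewrite mul1g.
by rewrite -mulgA entry_T // !IH (g0 j) 1?eq_sym // mulr0 if_same addr0.
Qed.

Lemma entry_row_power k j e a g c : k != j ->
  entry (rho (Spm k j e ^+ a * g)) k c =
  (entry (rho g) k c + (if e then 2 else -2) * a%:Z * entry (rho g) j c)%R.
Proof.
move=> kj; have Tj m : entry (rho (Spm k j e ^+ m * g)) j c = entry (rho g) j c.
  elim: m => [|m IH]; first by rewrite expg0 mul1g.
  by rewrite expgS -mulgA entry_T // eq_sym (negbTE kj) addr0.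
elim: a => [|a IH]; first by rewrite expg0 mul1g mulr0 mul0r addr0.
rewrite expgS -mulgA entry_T // eqxx Tj IH intS; by case: e {IH Tj} => /=; ring.
Qed.

(** The letters in row [k] commute, so those with column [j] can be collected in front. Two
    exponents occur because [^+] takes natural numbers. *)
Lemma row_gen_split k j B u : k != j -> gen (row_letter k B) u ->
  exists a b u', gen (row_letter k (B :\ j)) u' /\
    u = Spm k j true ^+ a * (Spm k j false ^+ b * u').
Proof.
move=> kj; elim=> [|s h [m [e [mB km ->]]] _ [a [b [u' [Lu' ->]]]]].
  by exists 0%N, 0%N, 1; split; rewrite ?expg0 ?mul1g //; apply: gen1.
have [->|mj] := eqVneq m j.
  case: e; first by exists a.+1, b, u'; rewrite expgS !mulgA.
  exists a, b.+1, u'; split=> //; rewrite expgS !mulgA; congr (_ * _ * _).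
  by apply: commuteX; apply: commute_row.
exists a, b, (Spm k m e * u'); split.
  by apply: genMl => //; exists m, e; rewrite !inE mj.
rewrite mulgA (commuteX a (commute_row f_rel e true km kj)) -!mulgA; congr (_ * _).
by rewrite !mulgA (commuteX b (commute_row f_rel e false km kj)).
Qed.

(** For [j] in [B] different from [k], the exponent sum of [Spm k j] in [u] is half the entry
    [(k, j)]; vanishing entries strip off one index of [B] at a time. *)
Lemma row_gen_eq1 k B u : gen (row_letter k B) u ->
  (forall j, k != j -> entry (rho u) k j = 0%R) -> u = 1.
Proof.
elim: {B}#|B|.+1 {-2}B (ltnSn #|B|) u => // N IH B BN u Lu u0.
case: (pickP [pred j | (j \in B) && (k != j)]) => [j /= /andP[jB kj]|B0]; last first.
  elim: Lu {u0} => // s h [j [e [jB kj _]]].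
  by have := B0 j; rewrite /= jB kj.
have [a [b [u' [Lu' Eu]]]] := row_gen_split kj Lu.
have jB' : j \notin B :\ j by rewrite !inE eqxx.
have jk : j != k by rewrite eq_sym.
have ab : a = b.
  have := u0 j kj; rewrite Eu !entry_row_power // (entry_row_gen_off Lu') // (negbTE kj).
  have -> : entry (rho (Spm k j false ^+ b * u')) j j = 1%R.
    suff /entry_row_gen -> : gen (row_letter k (j |: B)) (Spm k j false ^+ b * u') by rewrite ?eqxx.
    apply: genM; last first.
      by apply: gen_sub Lu' => s [m [e [+ km ->]]]; rewrite !inE => /andP[_ mB];
        apply: gen_incl; exists m, e; rewrite !inE mB orbT.
    elim: b {Eu} => [|b IHb]; first exact: gen1.
    by rewrite expgS; apply: genMl => //; exists j, false; rewrite !inE eqxx.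
  by rewrite (entry_row_gen _ Lu') // eqxx; clear; lia.
have uu' : u = u'.
  by rewrite Eu ab -(TV f k j true) expVgn mulVKg.
rewrite uu' in u0 *; apply: IH Lu' u0.
by move: BN; rewrite (cardsD1 j) jB.
Qed.

Lemma row_gen_exists k (B : {set 'I_n}) (v : 'I_n -> int) : k \notin B ->
  (forall j, j \in B -> ~~ odd `|v j|%N) ->
  exists2 u, gen (row_letter k B) u &
    forall j, j \in B -> entry (rho u) k j = v j.
Proof.
elim: {B}#|B|.+1 {-2}B (ltnSn #|B|) => // N IH B BN kB vB.
have [->|[j jB]] := set_0Vmem B.
  by exists 1; [apply: gen1 | move=> j; rewrite inE].
have kj : k != j by apply: contraNneq kB => ->.
have [|||u Lu uv] := IH (B :\ j).
- by move: BN; rewrite (cardsD1 j) jB.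
- by rewrite !inE (negbTE kB) andbF.
- by move=> m; rewrite !inE => /andP[_]; apply: vB.
have Lu' : gen (row_letter k B) u.
  apply: gen_sub Lu => s [m [e [+ km ->]]]; rewrite !inE => /andP[_ mB].
  by apply: gen_incl; exists m, e.
(* Each factor changes the entry [(k, j)] by 2, and [v j] is even. *)
exists (Spm k j (0 <= v j)%R ^+ (`|v j| %/ 2)%N * u).
  apply: genM => //; elim: (_ %/ 2)%N => [|a IHa]; first exact: gen1.
  by rewrite expgS; apply: genMl => //; exists j, (0 <= v j)%R.
move=> m mB; rewrite entry_row_power // (@entry_row_gen k B u j m Lu') 1?eq_sym //.
have [<-|jm] := eqVneq j m.
  rewrite (entry_row_gen_off Lu) ?(negbTE kj) ?add0r ?mulr1; last by rewrite !inE eqxx.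
  by have := vB j jB; move: (v j); clear => z; case: ifP; lia.
by rewrite mulr0 addr0 uv // !inE eq_sym jm.
Qed.

(** Letters avoiding [k] normalize the group of row [k]: [Ogen] at most changes a sign, and
    [Spm a b c] commutes with [Spm k j e] unless [j = a], where relator 9 applies. *)
Lemma letter_row_letter k (A : {set 'I_n}) s t : k \notin A -> letter A s -> row_letter k A t ->
  exists2 u, gen (row_letter k A) u & s * t = u * s.
Proof.
move=> kA Ls [j [e [jA kj ->]]]; case: Ls => [a b c aA bA ab|a aA]; last first.
  by rewrite O_T //; eexists; last reflexivity; apply: gen_incl; exists j; eexists.
have [ka kb] : k != a /\ k != b by split; apply: contraNneq kA => ->.
have [?|ja] := eqVneq j a; last first.
  exists (Spm k j e); first by apply: gen_incl; exists j, e.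
  by apply: commute_disj; rewrite // eq_sym.
subst j; exists (Spm k b (e != c) * Spm k b (e != c) * Spm k a e).
  by do 2?apply: genM; apply: gen_incl; [exists b | exists b | exists a]; eexists.
rewrite -[RHS]mulgA T_chain // !mulgA -(TV f k b (e == c)) mulgVK mulVg mul1g //.
Qed.

Lemma letter_row_gen k (A : {set 'I_n}) s u : k \notin A -> letter A s -> gen (row_letter k A) u ->
  exists2 u', gen (row_letter k A) u' & s * u = u' * s.
Proof.
move=> kA Ls; elim=> [|t h Lt _ [u' Lu' E]].
  by exists 1; [apply: gen1 | rewrite mulg1 mul1g].
have [v Lv E'] := letter_row_letter kA Ls Lt.
by exists (v * u'); [apply: genM | rewrite mulgA E' -mulgA E mulgA].
Qed.

Lemma O_row_gen k B u : gen (row_letter k B) u ->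
  exists2 u', gen (row_letter k B) u' & Ogen k * u = u' * Ogen k.
Proof.
elim=> [|t h [j [e [jB kj ->]]] _ [u' Lu' E]].
  by exists 1; [apply: gen1 | rewrite mulg1 mul1g].
rewrite mulgA O_T // -mulgA E mulgA; eexists; last reflexivity.
by apply: genMl => //; exists j; eexists.
Qed.

Lemma commute_O_gen k (A : {set 'I_n}) h : k \notin A -> gen (letter A) h -> commute (Ogen k) h.
Proof.
move=> kA; elim=> [|s h' Ls _ IH]; first exact: commute1.
apply: commuteM => //; case: Ls => [i j e iA jA ij|i _]; last exact: commute_OO.
have [ki kj] : k != i /\ k != j by split; apply: contraNneq kA => ->.
by rewrite /commute O_T // (negbTE ki) (negbTE kj) addbF.
Qed.

Lemma norm_ge k g : (`|coef k g k| <= norm k g)%R.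
Proof. by rewrite /norm (bigD1 k) //= lerDl sumr_ge0. Qed.

Lemma norm_lt2 k g : (norm k g < 2)%R ->
  `|coef k g k|%N = 1%N /\ forall i, i != k -> coef k g i = 0%R.
Proof.
have odd_k : odd `|coef k g k|%N by rewrite odd_coef eqxx.
rewrite /norm (bigD1 k) //= => g2.
have le i : i != k -> (`|coef k g i| <= \sum_(i0 < n | i0 != k) `|coef k g i0|)%R.
  by move=> ik; rewrite (bigD1 i) //= lerDl sumr_ge0.
have ge0 : (0 <= \sum_(i0 < n | i0 != k) `|coef k g i0|)%R by apply: sumr_ge0.
move: (\sum_(_ < n | _) _)%R g2 le ge0 => N g2 le ge0; split.
  by move: (coef k g k) odd_k g2 ge0; clear; lia.
move=> i /le; move: (coef k g k) (coef k g i) odd_k g2; clear; lia.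
Qed.

(** Along the path a letter [Spm k j e] extends [u], a letter avoiding [k] passes [u] and extends
    [h], and [Ogen k] passes [u], commutes with [h] and flips [b]. *)
Lemma conn2_normal_form (A : {set 'I_n}) k g : k \in A -> conn A k 2 1 g ->
  exists u h (b : bool), [/\ gen (row_letter k (A :\ k)) u,
    gen (letter (A :\ k)) h & g = u * (h * (if b then Ogen k else 1))].
Proof.
move=> kA; have kA' : k \notin A :\ k by rewrite !inE eqxx.
elim=> [|s g' Ls _ [u [h [b [Lu Lh E]]]] g'2 sg'2].
  by exists 1, 1, false; split; rewrite ?mulg1 //; apply: gen1.
have [x1' x0'] := norm_lt2 g'2.
have Ok i : i = k -> exists u h (b : bool), [/\ gen (row_letter k (A :\ k)) u,
    gen (letter (A :\ k)) h & Ogen i * g' = u * (h * (if b then Ogen k else 1))].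
  move=> ->; have [u' Lu' Ou] := O_row_gen Lu.
  exists u', h, (~~ b); split=> //; rewrite E mulgA Ou -mulgA; congr (_ * _).
  rewrite mulgA (commute_O_gen kA' Lh) -mulgA; congr (_ * _).
  by case: b {E}; rewrite ?OO ?mulg1.
have Lk t : letter (A :\ k) t -> exists u h (b : bool), [/\ gen (row_letter k (A :\ k)) u,
    gen (letter (A :\ k)) h & t * g' = u * (h * (if b then Ogen k else 1))].
  move=> Lt; have [u' Lu' tu] := letter_row_gen kA' Lt Lu.
  exists u', (t * h), b; split=> //; first exact: genMl.
  by rewrite E mulgA tu -!mulgA.
case: Ls sg'2 => [i j e iA jA ij|i iA] sg'2; last first.
  have [/Ok//|ik] := eqVneq i k.
  by apply: Lk; constructor; rewrite !inE ik.
(* A letter with column [k] would turn a zero entry into 2 or -2 and leave norm 1. *)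
have jk : j != k.
  apply/negP => /eqP ?; subst j; move: sg'2; rewrite norm_T // coefT // eqxx x0' //.
  move: x1' (norm_ge k g'); move: (norm k g') (coef k g' k); case: (e); clear; lia.
have [ik|ik] := eqVneq i k.
  exists (Spm i j e * u), h, b; split=> //; last by rewrite E !mulgA.
  by apply: genMl => //; exists j, e; rewrite !inE jk -ik.
by apply: Lk; constructor; rewrite ?inE ?ik ?jk.
Qed.

(** Block matrices: arbitrary on the indices in [A], the identity elsewhere. *)
Definition trivial_off (A : {set 'I_n}) g : Prop := forall i m, i \notin A ->
  entry (rho g) i m = (i == m)%:R%R /\ entry (rho g) m i = (m == i)%:R%R.

Lemma trivial_off_letter A s g : letter A s -> trivial_off A g -> trivial_off A (s * g).
Proof.
move=> Ls tg i m iA; have IH := fun m => tg i m iA.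
case: Ls => [a b e aA bA ab|a aA].
  have [ia ib] : i != a /\ b != i.
    by split; [apply: contraNneq iA => -> | apply: contraTneq bA => ->].
  rewrite !entry_T // (negbTE ia) addr0 !(IH m).1 !(IH _).2 (negbTE ib) mulr0.
  by rewrite if_same addr0.
have ia : i != a by apply: contraNneq iA => ->.
rewrite !entry_O (negbTE ia) (IH m).1 (IH m).2; split=> //.
by case: (m =P a) ia => // ->; rewrite eq_sym => /negbTE ->; rewrite oppr0.
Qed.

Lemma trivial_off_gen A s g : gen (letter A) s -> trivial_off A g -> trivial_off A (s * g).
Proof.
by elim=> [|t h Lt _ IH] tg; rewrite ?mul1g // -mulgA; apply: trivial_off_letter => //; exact: IH.
Qed.

Lemma entry_gen_off A h i m : gen (letter A) h -> i \notin A ->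
  entry (rho h) i m = (i == m)%:R%R /\ entry (rho h) m i = (m == i)%:R%R.
Proof.
move=> Lh; rewrite -[h]mulg1; apply: (trivial_off_gen Lh).
by move=> r c _; rewrite rho1 !entry1.
Qed.

Lemma rhoV g : rho g^-1 = (rho g)^-1.
Proof. by apply: (mulIg (rho g)); rewrite -rhoM !mulVg rho1. Qed.

(** In the normal form of [g], column [k] excludes the factor [Ogen k]. Then [u] and the inverse of
    [h] have the same image, whose row [k] is trivial, so [u = 1] and induction applies to [h]. *)
Theorem rho_injective_gen A g : gen (letter A) g -> rho g = 1 -> g = 1.
Proof.
elim: {A}#|A|.+1 {-2}A (ltnSn #|A|) g => // N IH A AN g Lg g1.
have [A0|[k kA]] := set_0Vmem A; first by apply: letter_gen_set0; rewrite -A0.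
have kA' : k \notin A :\ k by rewrite !inE eqxx.
have c : conn A k 2 1 g.
  apply: gen_conn => //; rewrite -(norm1 k).
  by apply: eq_bigr => i _; rewrite /coef rho1 g1.
have [u [h [b [Lu Lh E]]]] := conn2_normal_form kA c.
have ho : forall r, entry (rho (h * (if b then Ogen k else 1))) r k =
    (if b then - (r == k)%:R else (r == k)%:R)%R.
  move=> r; case: (b); rewrite ?mulg1 ?(entry_gen_off r Lh kA').2 //.
  rewrite -(commute_O_gen kA' Lh) entry_O (entry_gen_off r Lh kA').2.
  by case: eqP; rewrite ?oppr0.
have : entry (rho g) k k = 1%R by rewrite g1 entry1 eqxx.
rewrite E (entry_row_genM _ Lu); last first.
  by move=> r /negbTE rk; rewrite ho rk oppr0 if_same.
rewrite ho eqxx; case: b E {ho} => // E _; rewrite mulg1 in E; subst g.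
have u1 : u = 1.
  apply: (row_gen_eq1 Lu) => j /negbTE kj.
  have -> : rho u = rho h^-1.
    by apply: (mulIg (rho h)); rewrite -!rhoM mulVg rho1.
  by rewrite (entry_gen_off j (genV (@letterV _) Lh) kA').1 kj.
rewrite u1 !(mul1g, mulg1) in g1 *; apply: (IH (A :\ k)) => //.
by move: AN; rewrite (cardsD1 k) kA.
Qed.

(** Descents lead to norm 1, and [Ogen k] fixes the remaining sign. *)
Lemma reduce_column (A : {set 'I_n}) k g : k \in A -> trivial_off A g ->
  exists2 s, gen (letter A) s & forall i, coef k (s * g) i = (i == k)%:R%R.
Proof.
move=> kA tg.
have [s Ls s1] : exists2 s, gen (letter A) s & (norm k (s * g) < 2)%R.
  elim: {g}`|norm k g|%N.+1 {-2}g (ltnSn `|norm k g|%N) tg => // N IH g gN tg.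
  case: (ltrP 1%R (norm k g)) => g1; last first.
    by exists 1; [apply: gen1 | rewrite mul1g; exact: le_lt_trans g1 _].
  have sg : supported A k g.
    by move=> i iA; rewrite /coef (tg i k iA).1; case: eqP iA => // ->; rewrite kA.
  have [t dt] := descent_exists kA sg g1; have Lt := descent_letter dt.
  have [||s Ls s2] := IH (t * g); last by exists (s * t); rewrite -?mulgA //;
    apply: genM => //; apply: gen_incl.
    have ge0 h : (0 <= norm k h)%R by apply: sumr_ge0.
    move: (descent_lt dt) gN (ge0 g) (ge0 (t * g)).
    by move: (norm k g) (norm k (t * g)); clear; lia.
  exact: trivial_off_letter.
have [xk x0] := norm_lt2 s1.
have [xk1|xk1] := eqVneq (coef k (s * g) k) 1%R.
  exists s => // i; have [->//|ik] := eqVneq i k; exact: x0.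
exists (Ogen k * s); first by apply: genMl => //; constructor.
move=> i; rewrite -mulgA coefO; have [->|ik] := eqVneq i k; last exact: x0.
by move: (coef k (s * g) k) xk xk1; clear; lia.
Qed.

(** Column [k] is cleared by [s] on the left, row [k] by [u] on the right; induction applies to the
    remaining block. *)
Theorem rho_surjective_gen A g : trivial_off A g ->
  exists2 h, gen (letter A) h & rho h = rho g.
Proof.
elim: {A}#|A|.+1 {-2}A (ltnSn #|A|) g => // N IH A AN g tg.
have [A0|[k kA]] := set_0Vmem A.
  exists 1; first exact: gen1.
  by apply: entry_inj => i m; rewrite rho1 entry1 (tg i m _).1 // A0 inE.
have kA' : k \notin A :\ k by rewrite !inE eqxx.
have AA' i : i \notin A -> i \notin A :\ k by apply: contra; rewrite !inE => /andP[].
have [s Ls xs] := reduce_column kA tg.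
have tsg := trivial_off_gen Ls tg.
(* As column [k] is already that of the identity, row [k] of the product is the sum of the
   off-diagonal entries of both factors. *)
have [|u Lu uv] := @row_gen_exists k (A :\ k) (fun j => - entry (rho (s * g)) k j)%R kA'.
  move=> j; rewrite !inE => /andP[jk _]; rewrite abszN odd_entry eq_sym //.
have [||h Lh Eh] := IH (A :\ k) _ (s * g * u).
- by move: AN; rewrite (cardsD1 k) kA.
- move=> i m.
  have E r c : entry (rho (s * g * u)) r c =
      (if c == k then (r == k)%:R else if r == k then 0 else entry (rho (s * g)) r c)%R.
    rewrite rhoM entryM (bigD1 k) //= [entry _ r k]xs.
    rewrite (eq_bigr (fun t => entry (rho (s * g)) r t * (t == c)%:R)%R); last first.
      by move=> t tk; rewrite (entry_row_gen c Lu tk).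
    have [->|ck] := eqVneq c k.
      rewrite big1 ?addr0; last by move=> t /negbTE ->; rewrite mulr0.
      by rewrite (entry_row_gen_off Lu) // eqxx mulr1.
    rewrite (bigD1 c) //= eqxx mulr1 big1 ?addr0; last first.
      by move=> t /andP[_ /negbTE ->]; rewrite mulr0.
    case: eqP => [->|_]; rewrite ?mul0r ?add0r // mul1r.
    have [cA|cA] := boolP (c \in A); first by rewrite uv ?addNr // !inE ck.
    rewrite (entry_row_gen_off Lu) ?AA' // (tsg c k cA).2.
    by rewrite (eq_sym k) (negbTE ck) addr0.
  rewrite !E !inE negb_and negbK => /orP[/eqP ->|iA].
    rewrite eqxx; split.
      by rewrite (eq_sym k); case: eqP.
    by [].
  have ik : i != k by apply: contraNneq iA => ->.
  rewrite (negbTE ik) (tsg i m iA).1 (tsg i m iA).2; split.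
    by case: eqP => // ->; rewrite (negbTE ik).
  by case: eqP => // ->; rewrite eq_sym (negbTE ik).
have Lu' : gen (letter A) u.
  apply: gen_sub Lu => t [j [e [+ kj ->]]]; rewrite !inE => /andP[_ jA].
  by apply: gen_incl; constructor.
have Lh' : gen (letter A) h.
  apply: gen_sub Lh => t [i j e iA jA ij|i iA]; apply: gen_incl; constructor => //.
  - by move: iA; rewrite !inE => /andP[].
  - by move: jA; rewrite !inE => /andP[].
  - by move: iA; rewrite !inE => /andP[].
exists (s^-1 * h * u^-1).
  by apply: genM (genM (genV (@letterV _) Ls) Lh') (genV (@letterV _) Lu').
by rewrite !rhoM Eh !rhoM !rhoV -!mulgA mulgV mulg1 mulKg.
Qed.

End Representation.

(** * The presented group *)

Lemma commute_bracket (G : groupType) (a b : G) : a * b = b * a -> bracket a b = 1.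
Proof. by move=> ab; rewrite /bracket ab mulgK mulgV. Qed.

(** The arbitrary right factor [h] lets words be evaluated letter by letter as row operations. *)
Lemma Gamma2_ext n (g g' : Gamma2 n) :
  (forall h r c, entry (g * h) r c = entry (g' * h) r c) -> g = g'.
Proof. by move=> E; apply: entry_inj => r c; have := E 1 r c; rewrite !mulg1. Qed.

Lemma gens_val_relator n (r : free_group (gens n)) :
  relator r -> free_lift (@gens_val n) r = 1.
Proof.
pose f := @gens_val n.
have eT i j e (g : Gamma2 n) r' c (ij : i != j) :
    entry (Spm f i j e * g) r' c = _ :=
  @entry_T n _ f id (fun _ _ => erefl) (fun _ => erefl) i j e g r' c ij.
have eO i (g : Gamma2 n) r' c : entry (Ogen f i * g) r' c = _ := entry_Omat i g r' c.
have eS i j (g : Gamma2 n) r' c (ij : i != j) :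
    entry (Sgen f i j * g) r' c = _ := eT i j true g r' c ij.
case=> [i|i j ij|i j ij|i j ij|i j k ij ik jk|i j k ij ki kj
  |i j k l ij ik il jk jl kl|i j k ji ki jk|i j k kj ji ki|i j k ij ik ki ji jk kj];
  rewrite ?/bracket !(gmulfXn, gmulfM, gmulfV) /= ?lift_gO ?lift_gS.
- apply: Gamma2_ext => h m c; rewrite mul1g -mulgA !eO.
  by case: eqP => // _; rewrite opprK.
- apply: commute_bracket; apply: Gamma2_ext => h m c; rewrite -!mulgA !eO.
  by do 2?case: eqP => _.
- apply: Gamma2_ext => h m c; rewrite mul1g -!mulgA !(eO, eS) //.
  have ji : j != i by rewrite eq_sym.
  have sgs := (eqxx, negbTE ij, negbTE ji).
  have [->|mi] := eqVneq m i; first by rewrite ?sgs; ring.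
  have [->|mj] := eqVneq m j; first by rewrite ?sgs; ring.
  by rewrite ?addr0.
- apply: Gamma2_ext => h m c; rewrite mul1g -!mulgA !(eO, eS) //.
  have ji : j != i by rewrite eq_sym.
  have sgs := (eqxx, negbTE ij, negbTE ji).
  have [->|mi] := eqVneq m i; first by rewrite ?sgs; ring.
  have [->|mj] := eqVneq m j; first by rewrite ?sgs; ring.
  by rewrite ?addr0.
- apply: commute_bracket; apply: Gamma2_ext => h m c; rewrite -!mulgA !(eO, eS) //.
  have ji : j != i by rewrite eq_sym.
  have ki : k != i by rewrite eq_sym.
  have kj : k != j by rewrite eq_sym.
  have sgs := (eqxx, negbTE ij, negbTE ik, negbTE ji, negbTE jk, negbTE ki, negbTE kj).
  have [->|mi] := eqVneq m i; first by rewrite ?sgs; ring.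
  have [->|mj] := eqVneq m j; first by rewrite ?sgs; ring.
  have [->|mk] := eqVneq m k; first by rewrite ?sgs; ring.
  by rewrite ?addr0.
- apply: commute_bracket; apply: Gamma2_ext => h m c; rewrite -!mulgA !(eO, eS) //.
  have ik : i != k by rewrite eq_sym.
  have ji : j != i by rewrite eq_sym.
  have jk : j != k by rewrite eq_sym.
  have sgs := (eqxx, negbTE ij, negbTE ik, negbTE ji, negbTE jk, negbTE ki, negbTE kj).
  have [->|mi] := eqVneq m i; first by rewrite ?sgs; ring.
  have [->|mj] := eqVneq m j; first by rewrite ?sgs; ring.
  have [->|mk] := eqVneq m k; first by rewrite ?sgs; ring.
  by rewrite ?addr0.
- apply: commute_bracket; apply: Gamma2_ext => h m c; rewrite -!mulgA !(eO, eS) //.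
  have ji : j != i by rewrite eq_sym.
  have ki : k != i by rewrite eq_sym.
  have kj : k != j by rewrite eq_sym.
  have li : l != i by rewrite eq_sym.
  have lj : l != j by rewrite eq_sym.
  have lk : l != k by rewrite eq_sym.
  have sgs := (eqxx, negbTE ij, negbTE ik, negbTE il, negbTE ji, negbTE jk, negbTE jl, negbTE ki, negbTE kj, negbTE kl, negbTE li, negbTE lj, negbTE lk).
  have [->|mi] := eqVneq m i; first by rewrite ?sgs; ring.
  have [->|mj] := eqVneq m j; first by rewrite ?sgs; ring.
  have [->|mk] := eqVneq m k; first by rewrite ?sgs; ring.
  have [->|ml] := eqVneq m l; first by rewrite ?sgs; ring.
  by rewrite ?addr0.
- apply: commute_bracket; apply: Gamma2_ext => h m c; rewrite -!mulgA !(eO, eS) //.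
  have ij : i != j by rewrite eq_sym.
  have ik : i != k by rewrite eq_sym.
  have kj : k != j by rewrite eq_sym.
  have sgs := (eqxx, negbTE ij, negbTE ik, negbTE ji, negbTE jk, negbTE ki, negbTE kj).
  have [->|mi] := eqVneq m i; first by rewrite ?sgs; ring.
  have [->|mj] := eqVneq m j; first by rewrite ?sgs; ring.
  have [->|mk] := eqVneq m k; first by rewrite ?sgs; ring.
  by rewrite ?addr0.
- suff E : Sgen f k j * Sgen f j i = Sgen f k i * Sgen f k i * Sgen f j i * Sgen f k j.
    by rewrite E !mulgK mulgV.
  apply: Gamma2_ext => h m c; rewrite -!mulgA !(eO, eS) //.
  have ij : i != j by rewrite eq_sym.
  have ik : i != k by rewrite eq_sym.
  have jk : j != k by rewrite eq_sym.
  have sgs := (eqxx, negbTE ij, negbTE ik, negbTE ji, negbTE jk, negbTE ki, negbTE kj).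
  have [->|mi] := eqVneq m i; first by rewrite ?sgs; ring.
  have [->|mj] := eqVneq m j; first by rewrite ?sgs; ring.
  have [->|mk] := eqVneq m k; first by rewrite ?sgs; ring.
  by rewrite ?addr0.
- rewrite -[(Sgen f i k)^-1]/(Spm f i k false) -[(Sgen f k j)^-1]/(Spm f k j false) expg2.
  have sgs := (eqxx, negbTE ij, negbTE ik, negbTE ji, negbTE jk, negbTE ki, negbTE kj).
  set W := _ * Spm f k j false.
  (* On the rows [i], [j], [k] the word acts by the matrix with rows (1, -2, 2), (2, -3, 2), (2, -2,
     1), an involution. *)
  have eW (h : Gamma2 n) m c : entry (W * h) m c =
      (if m == i then entry h i c - 2 * entry h j c + 2 * entry h k c
       else if m == j then 2 * entry h i c - 3 * entry h j c + 2 * entry h k c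
       else if m == k then 2 * entry h i c - 2 * entry h j c + entry h k c
       else entry h m c)%R.
    rewrite /W -!mulgA.
    set z := Sgen f j k * _.
    have [zi zj zk] : [/\ entry z i c = entry h i c,
        entry z j c = (2 * entry h k c - 3 * entry h j c)%R &
        entry z k c = (entry h k c - 2 * entry h j c)%R].
      by split; rewrite /z !(eT, eS) // !sgs; ring.
    have zm : m != j -> m != k -> entry z m c = entry h m c.
      by move=> /negbTE mj /negbTE mk; rewrite /z !(eT, eS) // mj mk !addr0.
    move: z zi zj zk zm => z zi zj zk zm; rewrite !(eT, eS) // !sgs !addr0 zi zj zk.
    have [->|mi] := eqVneq m i; first by rewrite ?sgs zi; ring.
    have [->|mj] := eqVneq m j; first by rewrite ?sgs zj; ring.
    have [->|mk] := eqVneq m k; first by rewrite ?sgs zk; ring.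
    by rewrite !addr0 zm.
  apply: Gamma2_ext => h m c; rewrite mul1g -mulgA !eW !sgs.
  have [->|mi] := eqVneq m i; first by ring.
  have [->|mj] := eqVneq m j; first by ring.
  by have [->|mk] := eqVneq m k; first by ring.
Qed.

Lemma free_word_ind (X : choiceType) (P : free_group X -> Prop) :
  P 1 -> (forall a (e : bool) w, P w -> P ((if e then free_gen a else (free_gen a)^-1) * w)) ->
  forall w, P w.
Proof.
move=> P1 PM [s rs]; elim: s rs => [|[a e] s IH] rs.
  by have -> : FreeWord rs = 1 by apply: val_inj.
have rs' : reduced s by exact: path_sorted rs.
have -> : FreeWord rs = (if e then free_gen a else (free_gen a)^-1) * FreeWord rs'.
  apply: val_inj; have := foldr_push_nil rs; rewrite /= foldr_push_nil // => {1}<-.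
  by case: (e).
exact: PM.
Qed.

(** * The free group modulo a normal closure *)

Section PresentedGroup.

Variables (X : choiceType) (R : free_group X -> Prop).
Local Notation F := (free_group X).

Lemma normal_closure_normal : normal_subgroup (normal_closure R).
Proof.
split=> [N [] //|g h Rg Rh N NN RN|g Rg N NN RN|g h Rg N NN RN].
- by have [_ NM _ _] := NN; apply: NM; [apply: Rg | apply: Rh].
- by have [_ _ NV _] := NN; apply: NV; apply: Rg.
- by have [_ _ _ NJ] := NN; apply: NJ; apply: Rg.
Qed.

(** Made boolean classically, as the quotient construction requires. *)
Definition ncl_rel : rel F := fun u v => `[< normal_closure R (u * v^-1) >].

Lemma ncl_rel_refl : reflexive ncl_rel.
Proof. by move=> u; apply/asboolP; rewrite mulgV; case: normal_closure_normal. Qed.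

Lemma ncl_rel_sym : symmetric ncl_rel.
Proof.
have [_ _ NV _] := normal_closure_normal.
by move=> u v; apply/asboolP/asboolP => /NV; rewrite invgF.
Qed.

Lemma ncl_rel_trans : transitive ncl_rel.
Proof.
have [_ NM _ _] := normal_closure_normal.
move=> v u w /asboolP uv /asboolP vw; apply/asboolP.
by rewrite -(mulgVK v u) -mulgA; apply: NM.
Qed.

Canonical ncl_equiv := EquivRel ncl_rel ncl_rel_refl ncl_rel_sym ncl_rel_trans.

Definition presented := {eq_quot ncl_equiv}.
HB.instance Definition _ := Choice.on presented.
HB.instance Definition _ := EqQuotient.on presented.

Definition pr (u : F) : presented := \pi_presented u.

Lemma prP u v : pr u = pr v <-> normal_closure R (u * v^-1).
Proof. by split=> [/eqmodP/asboolP|h] //; apply/eqmodP/asboolP. Qed.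

Definition pr_one : presented := pr 1.
Definition pr_mul (a b : presented) : presented := pr (repr a * repr b).
Definition pr_inv (a : presented) : presented := pr (repr a)^-1.

Lemma pr_repr a : pr (repr a) = a.
Proof. exact: reprK. Qed.

Lemma pr_eqM u v u' v' : pr u = pr u' -> pr v = pr v' -> pr (u * v) = pr (u' * v').
Proof.
have [_ NM _ NJ] := normal_closure_normal.
move=> /prP uu' /prP vv'; apply/prP.
have -> : u * v * (u' * v')^-1 = u * (v * v'^-1) * u^-1 * (u * u'^-1).
  by rewrite invgM !mulgA mulgVK.
by apply: NM => //; apply: NJ.
Qed.

Lemma pr_mulE u v : pr_mul (pr u) (pr v) = pr (u * v).
Proof. by apply: pr_eqM; rewrite pr_repr. Qed.

Lemma pr_mulA : associative pr_mul.
Proof.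
by move=> a b c; rewrite -(pr_repr a) -(pr_repr b) -(pr_repr c) !pr_mulE mulgA.
Qed.

Lemma pr_mul1 : left_id pr_one pr_mul.
Proof. by move=> a; rewrite -(pr_repr a) pr_mulE mul1g. Qed.

Lemma pr_mulr1 : right_id pr_one pr_mul.
Proof. by move=> a; rewrite -(pr_repr a) pr_mulE mulg1. Qed.

Lemma pr_mulV : left_inverse pr_one pr_inv pr_mul.
Proof. by move=> a; rewrite -{2}(pr_repr a) pr_mulE mulVg. Qed.

Lemma pr_mulrV : right_inverse pr_one pr_inv pr_mul.
Proof. by move=> a; rewrite -{1}(pr_repr a) pr_mulE mulgV. Qed.

HB.instance Definition _ := isGroup.Build presented
  pr_mulA pr_mul1 pr_mulr1 pr_mulV pr_mulrV.

Lemma prM u v : pr (u * v) = pr u * pr v.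
Proof. by rewrite -pr_mulE. Qed.

Lemma pr_eq1 u : pr u = 1 <-> normal_closure R u.
Proof. by rewrite -[1]/(pr 1) prP invg1 mulg1. Qed.

Lemma prV u : pr u^-1 = (pr u)^-1.
Proof. by apply: (mulIg (pr u)); rewrite -prM !mulVg. Qed.

Lemma free_lift_pr w : free_lift (fun a => pr (free_gen a)) w = pr w.
Proof.
elim/free_word_ind: w => [|a e w IH]; first by rewrite gmulf1.
rewrite prM gmulfM /= IH; congr (_ * _).
by case: e; rewrite ?gmulfV /= free_lift_gen // prV.
Qed.

End PresentedGroup.

(** * Words, finiteness of the relators, and the presentation *)

Lemma S_val n (G : groupType) (f : gens n -> G) p : Sgen f (val p).1 (val p).2 = f (inl p).
Proof. by rewrite /Sgen -surjective_pairing valK. Qed.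

Lemma gen_lift n (G : groupType) (f : gens n -> G) w :
  (forall r, relator r -> free_lift f r = 1) ->
  gen (letter f [set: 'I_n]) (free_lift f w).
Proof.
move=> f_rel; elim/free_word_ind: w => [|a e w IH]; first by rewrite gmulf1; apply: gen1.
rewrite gmulfM /=; apply: genMl => //.
have -> : free_lift f (if e then free_gen a else (free_gen a)^-1) =
    if e then f a else (f a)^-1 by case: e; rewrite ?gmulfV /= free_lift_gen.
case: a => [p|i].
  by rewrite -S_val; apply: (@LetterT _ _ f [set: 'I_n] (val p).1 (val p).2 e);
    rewrite ?inE //; exact: (valP p).
have -> : (if e then f (inr i) else (f (inr i))^-1) = Ogen f i.
  by case: e => //; exact: OV.
by constructor; rewrite inE.
Qed.

Lemma lift_gen n (G : groupType) (f : gens n -> G) A g :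
  gen (letter f A) g -> exists w, free_lift f w = g.
Proof.
elim=> [|s h Ls _ [w <-]]; first by exists 1; rewrite gmulf1.
case: Ls => [i j e _ _ ij|i _].
  exists ((if e then gS ij else (gS ij)^-1) * w); rewrite gmulfM; congr (_ * _).
  by case: e; rewrite ?gmulfV /= lift_gS.
by exists (gO i * w); rewrite gmulfM /= lift_gO.
Qed.

(** All ten words are listed for every quadruple of indices. Filtering by [relator] discards the
    spurious words from coinciding indices. *)
Lemma relator_finite n : exists rs : seq (free_group (gens n)), forall r, relator r <-> r \in rs.
Proof.
pose s (i j : 'I_n) : free_group (gens n) :=
  if insub (i, j) is Some p then free_gen (inl p) else 1.
have sE i j (ij : i != j) : gS ij = s i j by rewrite /s insubT.
pose o := @gO n.
pose I4 := ('I_n * 'I_n * 'I_n * 'I_n)%type.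
pose words (t : I4) := let: (i, j, k, l) := t in
  [:: o i ^+ 2; bracket (o i) (o j); (o i * s i j) ^+ 2; (o j * s i j) ^+ 2;
      bracket (o i) (s j k); bracket (s k i) (s k j); bracket (s i j) (s k l);
      bracket (s j i) (s k i); bracket (s k j) (s j i) * s k i ^- 2;
      (s i j * (s i k)^-1 * s k i * s j i * s j k * (s k j)^-1) ^+ 2].
exists [seq r <- flatten [seq words t | t <- enum {: I4}] | `[< relator r >]].
move=> r; rewrite mem_filter; split=> [Rr|/andP[/asboolP //]].
apply/andP; split; first exact/asboolP.
have memw i j k l m : m < 10 ->
    nth 1 (words (i, j, k, l)) m \in flatten [seq words t | t <- enum {: I4}].
  move=> m10; apply/flattenP; exists (words (i, j, k, l)); last exact: mem_nth.
  by apply: map_f; rewrite mem_enum.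
case: Rr => [i|i j _|i j ij|i j ij|i j k _ _ jk|i j k _ ki kj
  |i j k l ij _ _ _ _ kl|i j k ji ki _|i j k kj ji ki|i j k ij ik ki ji jk kj];
  rewrite ?sE.
- exact: (memw i i i i 0%N).
- exact: (memw i j i i 1%N).
- exact: (memw i j i i 2%N).
- exact: (memw i j i i 3%N).
- exact: (memw i j k i 4%N).
- exact: (memw i j k i 5%N).
- exact: (memw i j k l 6%N).
- exact: (memw i j k i 7%N).
- exact: (memw i j k i 8%N).
- exact: (memw i j k i 9%N).
Qed.

Lemma lift_normal_closure n w :
  normal_closure (@relator n) w -> free_lift (@gens_val n) w = 1.
Proof.
move=> Nw; apply: (Nw (fun v => free_lift (@gens_val n) v = 1)); last exact: gens_val_relator.
split=> [|g h|g|g h]; rewrite ?gmulf1 ?gmulfM ?gmulfV //=.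
- by move=> -> ->; rewrite mulg1.
- by move=> ->; rewrite invg1.
- by move=> ->; rewrite mulg1 mulgV.
Qed.

Theorem corollary1p1 (n : nat) (hn : 4 <= n) :
  is_finite_presentation (@gens_val n) (@relator n).
Proof.
split; last exact: relator_finite; split=> [g|w].
  (* The group is Gamma_n[2] itself with the identity as representation; for the full index set
     [trivial_off] is vacuous. *)
  have [h Lh <-] := @rho_surjective_gen n _ _ (@gens_val_relator n) id (fun _ _ => erefl)
    (fun _ => erefl) [set: 'I_n] g (fun i m => ltac:(by rewrite inE)).
  exact: lift_gen Lh.
split=> [w1|]; last exact: lift_normal_closure.
pose f a := pr (@relator n) (free_gen a).
have f_rel r : relator r -> free_lift f r = 1.
  by move=> Rr; rewrite free_lift_pr; apply/pr_eq1 => N _; apply.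
(* The induced map on the presented group, computed on representatives; [rho_pr] shows independence
   of the choice. *)
pose rho (a : presented (@relator n)) := free_lift (@gens_val n) (repr a).
have rho_pr u : rho (pr _ u) = free_lift (@gens_val n) u.
  apply: divg1_eq; rewrite -gmulfF; apply: lift_normal_closure.
  by apply/prP; rewrite pr_repr.
have rhoM a b : rho (a * b) = rho a * rho b.
  by rewrite -(pr_repr a) -(pr_repr b) -prM !rho_pr gmulfM.
have rho_f a : rho (f a) = gens_val a by rewrite rho_pr free_lift_gen.
apply/pr_eq1; apply: (rho_injective_gen f_rel rhoM rho_f) (_ : _ = 1).
  by rewrite -free_lift_pr; apply: gen_lift.
by rewrite rho_pr.
Qed.
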